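(* Let $p$ be a monic hyperbolic polynomial of degree $d\ge2$ with connected Julia set $J_p$, and let $\epsilon>0$ be the constant (independent of $a$) of the context, with model map $\psi:J_p\times\mathbb{C}\to J_p\times\mathbb{C}$. There exists $a_0>0$ such that for all parameters $a$ with $0<|a|<a_0$ there exists a semi-conjugacy $\Psi:J_p\times\mathbb{C}\to J^+$ which makes the diagram commute, i.e. $$H_{p,a}\circ\Psi=\Psi\circ\psi\quad\text{on }J_p\times\mathbb{C}.$$
   Context: For $a\in\mathbb{C}\setminus\{0\}$ the Hénon map is $H_{p,a}(x,y)=(p(x)+ay,\,ax)$, a biholomorphism of $\mathbb{C}^2$. $K^{+}$ is the set of points with bounded forward orbit under $H_{p,a}$ and $J^+=\partial K^+$. $p$ is hyperbolic if it is expanding on a neighborhood of $J_p$; then $p'\ne0$ on $J_p$. Model map: for some (small enough) $\epsilon>0$ independent of $a$, depending on $p$ and on a fixed large $r>3$, $$\psi(\zeta,z)=\left(p(\zeta),\ \epsilon\zeta-\frac{\epsilon^2 z}{p'(\zeta)}\right).$$ It maps $J_p\times\mathbb{D}_r$ into itself, $\mathbb{D}_r=\{|z|<r\}$; the same formula defines it on $J_p\times\mathbb{C}$. Here $r$ depends only on $p$ and is so large that $J_p\subset\mathbb{D}_r$ and, for all sufficiently small $|a|>0$, the points with bounded forward and backward $H_{p,a}$-orbits lie in $\{|x|\le r,|y|\le r\}$ and the points with unbounded forward orbit form the set $\bigcup_{k\ge0}H_{p,a}^{-k}(\{|x|\ge\max(|y|,r)\})$. A semi-conjugacy is a continuous surjective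 map intertwining the two dynamical systems. *)

(* Defs.v *)
From mathcomp Require Export all_boot all_order all_algebra.
From mathcomp Require Export complex.
From mathcomp Require Export all_classical all_reals all_analysis.

Set Implicit Arguments.
Unset Strict Implicit.
Unset Printing Implicit Defensive.

Export Order.TTheory GRing.Theory Num.Theory numFieldNormedType.Exports.

Local Open Scope classical_set_scope.
Local Open Scope ring_scope.
Local Open Scope complex_scope.

(* R[i] carries no canonical topology by itself. Seen as a numClosedFieldType
   it inherits the one given by its norm. The norm `|x| takes its values in
   the nonnegative reals inside R[i], so real bounds r are written r%:C. *)
Definition Cplx (R : realType) : numClosedFieldType := R[i].

Definition frontier (T : topologicalType) (A : set T) : set T :=
  closure A `\` A°.

Definition bounded_orbit (K : numFieldType) (V : pseudoMetricNormedZmodType K)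
    (f : V -> V) (v : V) : Prop :=
  bounded_set [set iter n f v | n in setT].

Definition semiconjugacy (X Y : topologicalType) (A : set X) (f : X -> X)
    (B : set Y) (g : Y -> Y) (Psi : X -> Y) : Prop :=
  [/\ set_fun A A f, set_fun B B g,
      {within A, continuous Psi}, Psi @` A = B &
      forall x, A x -> g (Psi x) = Psi (f x)].

Section Dynamics.
Variable R : realType.
Local Notation C := (Cplx R).
Implicit Types (p : {poly C}) (a : C) (r eps : R).

Definition disk r : set C := [set z | `|z| < r%:C].

Definition filled_Julia p : set C := [set z | bounded_orbit (horner p) z].

Definition Julia p : set C := frontier (filled_Julia p).

Definition iter_poly p (n : nat) : {poly C} := iter n (fun q => p \Po q) 'X.

(* Uniform expansion along every orbit segment whose points at which p is
   applied all lie in U. *)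
Definition expanding_on p (U : set C) : Prop :=
  exists c lambda : R, [/\ 0 < c, 1 < lambda &
    forall (n : nat) (z : C),
      (forall k, (k < n)%N -> U (iter k (horner p) z)) ->
      (c * lambda ^+ n)%:C <= `|(iter_poly p n)^`().[z]| ].

Definition hyperbolic p : Prop :=
  exists U : set C, [/\ open U, Julia p `<=` U & expanding_on p U].

Definition henon p a (v : C * C) : C * C := (p.[v.1] + a * v.2, a * v.1).

Definition henon_inv p a (w : C * C) : C * C :=
  (w.2 / a, (w.1 - p.[w.2 / a]) / a).

Lemma henonK p a : a != 0 -> cancel (henon p a) (henon_inv p a).
Proof.
by move=> a0 [x y]; rewrite /henon /henon_inv/= !(mulrC a) mulfK// addrAC subrr add0r mulfK.
Qed.

Lemma henon_invK p a : a != 0 -> cancel (henon_inv p a) (henon p a).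
Proof.
by move=> a0 [x y]; rewrite /henon /henon_inv/= !(mulrC a) !divfK// addrC subrK.
Qed.

Definition Kplus p a : set (C * C) := [set v | bounded_orbit (henon p a) v].

Definition Kminus p a : set (C * C) := [set v | bounded_orbit (henon_inv p a) v].

Definition Jplus p a : set (C * C) := frontier (Kplus p a).

Definition closed_bidisk r : set (C * C) :=
  [set v | `|v.1| <= r%:C /\ `|v.2| <= r%:C].

Definition escape_region r : set (C * C) :=
  [set v | Num.max `|v.2| r%:C <= `|v.1| ].

Definition admissible_radius p r : Prop :=
  [/\ 3 < r, Julia p `<=` disk r &
    exists2 a1 : R, 0 < a1 &
      forall a, 0 < `|a| < a1%:C ->
        Kplus p a `&` Kminus p a `<=` closed_bidisk r /\
        ~` Kplus p a =
          \bigcup_k (iter k (henon p a) @^-1` escape_region r)].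

Definition model p eps (v : C * C) : C * C :=
  (p.[v.1], eps%:C * v.1 - eps%:C ^+ 2 * v.2 / p^`().[v.1]).

End Dynamics.

(* Main.v *)
Require Import Defs.
From mathcomp Require Import ring lra separable cyclotomic cyclic.

Set Implicit Arguments.
Unset Strict Implicit.
Unset Printing Implicit Defensive.

Local Open Scope classical_set_scope.
Local Open Scope ring_scope.
Local Open Scope complex_scope.

(** Write [psi] for the model map, [H] for the Hénon map and [J] for the Julia
    set. Since [H] is invertible and [psi] contracts the fibres of
    [J x C] into the disk of radius [r], it is enough to build a continuous
    [f = (X, Y)] with [H o f = f o psi] on [J x D_r] whose image meets every
    orbit of [H] in [J+]: then [Psi = H^-n o f o psi^n], with [n] large
    depending on the point, is the required map ([extensionE],
    [extension_cvg], [global_semiconjugacy]).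

    Hyperbolicity provides a weight [sig], between [1] and a constant [S] on
    [J], with [sig (p z) |p'(z)| >= mu sig z] and [mu > 1]
    ([hyperbolic_metric]). Measured with it, [p] expands near [J] by a
    definite factor at each step, and for small [|a|] so does [H] in the
    horizontal direction. Everything below is extracted from this expansion.

    Construction of [f] ([local_semiconjugacy]). The equation
    [p(X) + a Y = X o psi] is solved for [X] by a Newton step, a contraction
    because [p'] expands. The equation [Y o psi = a X] prescribes [Y] on the
    image of [psi], which in each fibre consists of [d] tiny disjoint disks,
    one for each preimage in [J] of the base point. There one sets
    [Y = a X o psi^-1], multiplied by a cutoff which leaves [Y] free elsewhere.
    Both prescriptions together form one contraction ([straighten]) of a
    complete space of continuous maps. A semiconjugacy need not be injective,
    so [Y] does not have to match the topology of the fibres of [J+]: far from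
    the small disks [Y] is chosen so that it covers the unit disk
    ([filler_onto]), and surjectivity comes for free.

    The image of [f] is in [J+]. Orbits of points of the image shadow orbits
    of [J], hence are bounded. On a horizontal line the first coordinate of
    [H^n] is a polynomial whose derivative grows exponentially along such an
    orbit ([shadow_deriv_growth]); by Cauchy's estimate these polynomials
    cannot stay bounded on a fixed disk, so the point is not interior to [K+]
    ([shadow_not_interior]).

    The image of [f] meets every orbit in [J+]. Let [v] be in [J+]. A point of
    the orbit of [v] whose first coordinate is far from [J] would either be
    trapped in the filled Julia set of [p], robustly, which makes [v] interior
    to [K+], or be forced to escape ([far_step], [far_escape_time]). So the
    first coordinates of the orbit eventually stay near [J]
    ([Jplus_eventually_near]), and they are shadowed by the orbit of some [z]
    in [J] ([shadowing]). By expansion a point is determined by its second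
    coordinate and the orbit of [J] that it shadows ([shadow_unique]); since
    [Y] covers the unit disk, some [f (z, w)] has the right second coordinate
    and is therefore on the orbit of [v]. *)


(** * The real-valued modulus on the complex numbers *)

(** Real-valued, so that inequalities between moduli live in an ordered field;
    the norm of the complex numbers takes its values in the complex numbers. *)
Definition nrm (R : realType) (z : Cplx R) : R := complex.Re `|z|.

Section RealNorm.
Variable R : realType.
Local Notation C := (Cplx R).
Implicit Types (z w : C).

Lemma normE z : `|z| = (nrm z)%:C.
Proof. by rewrite /nrm RRe_real// normr_real. Qed.

Lemma nrm_ge0 z : 0 <= nrm z.
Proof. by rewrite -ler0c -normE. Qed.

Lemma nrmD z w : nrm (z + w) <= nrm z + nrm w.
Proof. by rewrite -lecR rmorphD /= -!normE ler_normD. Qed.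

Lemma nrmN z : nrm (- z) = nrm z.
Proof. by rewrite /nrm normrN. Qed.

Lemma nrmBC z w : nrm (z - w) = nrm (w - z).
Proof. by rewrite -nrmN opprB. Qed.

Lemma nrmB z w : nrm (z - w) <= nrm z + nrm w.
Proof. by rewrite -[nrm w]nrmN nrmD. Qed.

Lemma nrm_tri w z t : nrm (z - t) <= nrm (z - w) + nrm (w - t).
Proof. by rewrite -(subrKA w z) nrmD. Qed.

Lemma nrm_lb z w : nrm z - nrm w <= nrm (z - w).
Proof. by have := nrmD (z - w) w; rewrite subrK; lra. Qed.

Lemma nrmM z w : nrm (z * w) = nrm z * nrm w.
Proof.
by apply: (@complexI R); rewrite rmorphM /= -!normE normrM.
Qed.

Lemma nrm0 : nrm (0 : C) = 0.
Proof. by rewrite /nrm normr0. Qed.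

Lemma nrm1 : nrm (1 : C) = 1.
Proof. by rewrite /nrm normr1. Qed.

Lemma nrmX z n : nrm (z ^+ n) = nrm z ^+ n.
Proof. by elim: n => [|n IH]; rewrite ?expr0 ?nrm1// !exprS nrmM IH. Qed.

Lemma nrm_eq0 z : (nrm z == 0) = (z == 0).
Proof. by rewrite -(inj_eq (@complexI R)) -normE normr_eq0. Qed.

Lemma nrm_gt0 z : (0 < nrm z) = (z != 0).
Proof. by rewrite lt_def nrm_ge0 nrm_eq0 andbT. Qed.

Lemma nrmV z : nrm z^-1 = (nrm z)^-1.
Proof.
by apply: (@complexI R); rewrite -normE normfV normE -fmorphV.
Qed.

Lemma nrm_real (x : R) : nrm (x%:C) = `|x|.
Proof. 
apply: (@complexI R); rewrite -normE normc_def /= expr0n /= addr0.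
by rewrite sqrtr_sqr.
Qed.

Lemma nrm_nat n : nrm (n%:R : C) = n%:R.
Proof. by rewrite -[n%:R](rmorph_nat (real_complex R)) /= nrm_real normr_nat. Qed.

Lemma nrm_sum (I : Type) (s : seq I) (P : pred I) (F : I -> C) :
  nrm (\sum_(i <- s | P i) F i) <= \sum_(i <- s | P i) nrm (F i).
Proof.
elim/big_rec2: _ => [|i y x _ h]; first by rewrite nrm0.
by apply: le_trans (nrmD _ _) _; rewrite lerD2l.
Qed.

Lemma nrm_le0 z : (nrm z <= 0) = (z == 0).
Proof. by rewrite -nrm_eq0 eq_le nrm_ge0 andbT. Qed.

Lemma nrm_small0 z : (forall e, 0 < e -> nrm z <= e) -> z = 0.
Proof.
move=> h; apply/eqP; rewrite -nrm_le0; apply/ler_addgt0Pl => e e0.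
by rewrite addr0 h.
Qed.

Lemma ReB z w : complex.Re (z - w) = complex.Re z - complex.Re w.
Proof. by case: z w => [a b] [c d]. Qed.

Lemma ImB z w : complex.Im (z - w) = complex.Im z - complex.Im w.
Proof. by case: z w => [a b] [c d]. Qed.

Lemma nrm_Re z : `|complex.Re z| <= nrm z.
Proof.
rewrite /nrm normc_def /= -sqrtr_sqr ler_sqrt ?addr_ge0 ?sqr_ge0//.
by rewrite lerDl sqr_ge0.
Qed.

Lemma nrm_Im z : `|complex.Im z| <= nrm z.
Proof.
rewrite /nrm normc_def /= -sqrtr_sqr ler_sqrt ?addr_ge0 ?sqr_ge0//.
by rewrite lerDr sqr_ge0.
Qed.

Lemma nrm_ReIm z : nrm z <= `|complex.Re z| + `|complex.Im z|.
Proof.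
rewrite /nrm normc_def /= -[leRHS]ger0_norm ?addr_ge0// -sqrtr_sqr ler_sqrt ?sqr_ge0//.
rewrite -(real_normK (num_real (complex.Re z))) -(real_normK (num_real (complex.Im z))).
by have := mulr_ge0 (normr_ge0 (complex.Re z)) (normr_ge0 (complex.Im z)); nra.
Qed.

Lemma nbhs_nrm z (P : set C) :
  nbhs z P <-> exists2 e : R, 0 < e & forall w, nrm (z - w) < e -> P w.
Proof.
split=> [/nbhs_ballP [e e0 he]|[e e0 he]].
  have er : e = (complex.Re e)%:C by rewrite RRe_real// gtr0_real.
  exists (complex.Re e); first by rewrite -ltcR -er.
  by move=> w hw; apply: he; rewrite -ball_normE /ball_ /= normE er ltcR.
apply/nbhs_ballP; exists e%:C => /=; first by rewrite ltcR.
move=> w; rewrite -ball_normE /ball_ /= normE ltcR; exact: he.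
Qed.

Lemma cvg_nrm (T : Type) (F : set_system T) (FF : Filter F) (f : T -> C) z :
  f x @[x --> F] --> z <->
  forall e : R, 0 < e -> \forall x \near F, nrm (z - f x) < e.
Proof.
split=> [h e e0|h].
  by apply: (h [set w | nrm (z - w) < e]); apply/nbhs_nrm; exists e.
move=> P /nbhs_nrm [e e0 he].
by apply: filterS (h _ e0) => x; apply: he.
Qed.

Lemma closed_nrm (A : set C) : closed A <->
  forall z, (forall e : R, 0 < e -> exists2 w, A w & nrm (z - w) < e) -> A z.
Proof.
split=> [cA z h|h z cz].
  apply: cA => B /nbhs_nrm [e e0 he].
  by have [w Aw hw] := h e e0; exists w; split=> //; apply: he.
apply: h => e e0.
have [|w [Aw hw]] := cz [set w | nrm (z - w) < e].
  by apply/nbhs_nrm; exists e.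
by exists w.
Qed.

(** Completeness, with the explicit rate needed for the contraction and for the
    limit of finite shadowings; the limit is taken on real and imaginary parts. *)
Lemma nrm_geometric_cvg (u : nat -> C) (B k : R) : 0 <= B -> 0 < k < 1 ->
  (forall n, nrm (u n.+1 - u n) <= B * k ^+ n) ->
  exists l, forall n, nrm (l - u n) <= B / (1 - k) * k ^+ n.
Proof.
move=> B0 /andP[k0 k1] hu.
have k1' : 0 < 1 - k by lra.
have hmn n m : nrm (u (n + m)%N - u n) <= B / (1 - k) * k ^+ n * (1 - k ^+ m).
  elim: m => [|m IH]; first by rewrite addn0 subrr nrm0 expr0 subrr mulr0.
  apply: le_trans (nrm_tri (u (n + m)%N) _ _) _; rewrite addnS.
  apply: le_trans (lerD (hu _) IH) _.
  rewrite le_eqVlt; apply/orP; left; apply/eqP; rewrite exprS exprD; field.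
  by apply/eqP; lra.
have hmn' n m : nrm (u (n + m)%N - u n) <= B / (1 - k) * k ^+ n.
  apply: le_trans (hmn n m) _.
  have c0 : 0 <= B / (1 - k) * k ^+ n.
    by rewrite mulr_ge0 ?divr_ge0 ?exprn_ge0// ltW.
  by rewrite ler_piMr// gerBl exprn_ge0// ltW.
have small (e : R) : 0 < e -> exists n, B / (1 - k) * k ^+ n < e.
  move=> e0.
  have : (fun n => B / (1 - k) * k ^+ n) @ \oo --> (0 : R).
    have := @cvg_geometric R (B / (1 - k)) k; apply.
    by rewrite ger0_norm// ltW.
  move/cvgrPdist_lt => /(_ e e0) [n _ hn]; exists n.
  have := hn n (leqnn n) => /=; rewrite sub0r normrN; apply: le_lt_trans.
  exact: ler_norm.
have cau (f : C -> R) : (forall z w, `|f z - f w| <= nrm (z - w)) ->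
    cvgn (fun n => f (u n)).
  move=> hf; apply/cauchy_cvgP/cauchy_ballP => e e0.
  have [n hn] := small (e / 2) (divr_gt0 e0 (ltr0Sn _ 1)).
  have ball1 m : (n <= m)%N -> `|f (u m) - f (u n)| < e / 2.
    move=> nm; apply: le_lt_trans (hf _ _) _.
    by apply: le_lt_trans hn; rewrite -(subnKC nm) hmn'.
  pose A := [set x | exists2 m, (n <= m)%N & x = f (u m)].
  exists (A, A) => /=.
    by split; exists n => // m nm; exists m.
  move=> [_ _] [/= [i /ball1 hi ->] [j /ball1 hj ->]].
  rewrite -ball_normE /ball_ /=.
  have := ler_normD (f (u i) - f (u n)) (f (u n) - f (u j)).
  rewrite addrA subrK [`|f (u n) - _|]distrC; lra.
have cR := cau _ (fun z w => eq_ind _ (fun x => `|x| <= _) (nrm_Re (z - w)) _ (ReB z w)).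
have cI := cau _ (fun z w => eq_ind _ (fun x => `|x| <= _) (nrm_Im (z - w)) _ (ImB z w)).
pose l : C := (limn (fun n => complex.Re (u n)) +i* limn (fun n => complex.Im (u n)))%C.
exists l => n.
apply/ler_addgt0Pr => e e0.
have e20 : 0 < e / 2 by lra.
move/cvgrPdist_lt: cR => /(_ _ e20) [i _ hi].
move/cvgrPdist_lt: cI => /(_ _ e20) [j _ hj].
pose m := (n + (i + j))%N.
have him := hi m (leq_trans (leq_addr _ _) (leq_addl _ _)).
have hjm := hj m (leq_trans (leq_addl _ _) (leq_addl _ _)).
rewrite /= in him hjm.
apply: le_trans (nrm_tri (u m) _ _) _; rewrite addrC lerD ?hmn'//.
apply: le_trans (nrm_ReIm _) _.
rewrite ReB ImB /l /=; lra.
Qed.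

Lemma geometric_exceeds (c q : R) : 0 < c -> 1 < q ->
  forall B : R, exists n, B < c * q ^+ n.
Proof.
move=> c0 q1 B.
have hb n : 1 + n%:R * (q - 1) <= q ^+ n.
  elim: n => [|n IH]; first by rewrite mul0r addr0 expr0.
  rewrite exprS -natr1.
  have n0 : 0 <= n%:R * ((q - 1) * (q - 1)) by rewrite !mulr_ge0//; lra.
  have : q * (1 + n%:R * (q - 1)) <= q * q ^+ n by rewrite ler_pM2l//; lra.
  by apply: le_trans; lra.
have cq : 0 < c * (q - 1) by apply: mulr_gt0; lra.
exists (Num.truncn (Num.max 0 B / (c * (q - 1)))).+1.
set m := Num.truncn _.
have : Num.max 0 B < m.+1%:R * (c * (q - 1)).
  rewrite -ltr_pdivrMr//.
  have hm : 0 <= Num.max 0 B / (c * (q - 1)).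
    by apply: divr_ge0; [rewrite le_max lexx|exact: ltW].
  by have /andP[] := truncn_itv hm.
have : B <= Num.max 0 B by rewrite le_max lexx orbT.
have : c * (1 + m.+1%:R * (q - 1)) <= c * q ^+ m.+1 by rewrite ler_pM2l.
lra.
Qed.

End RealNorm.

(** * Estimates for complex polynomials *)

Section Polynomials.
Variable R : realType.
Local Notation C := (Cplx R).
Implicit Types (z w x : C) (p q : {poly C}).

Lemma poly_bound p (B : R) : 0 <= B ->
  exists2 M : R, 0 <= M & forall x, nrm x <= B -> nrm p.[x] <= M.
Proof.
move=> B0; elim/poly_ind: p => [|q c [M M0 hM]].
  by exists 0 => // x _; rewrite horner0 nrm0.
exists (M * B + nrm c) => [|x hx].
  by rewrite addr_ge0 ?nrm_ge0// mulr_ge0.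
rewrite hornerMXaddC; apply: le_trans (nrmD _ _) _.
by rewrite lerD2r nrmM ler_pM ?nrm_ge0// hM.
Qed.

Lemma poly_lip p (B : R) : 0 <= B ->
  exists2 M : R, 0 <= M & forall x y, nrm x <= B -> nrm y <= B ->
    nrm (p.[x] - p.[y]) <= M * nrm (x - y).
Proof.
move=> B0; elim/poly_ind: p => [|q c [M M0 hM]].
  by exists 0 => // x y _ _; rewrite !horner0 subr0 nrm0 mul0r.
have [N N0 hN] := poly_bound q B0.
exists (B * M + N) => [|x y hx hy]; first by rewrite addr_ge0// mulr_ge0.
rewrite !hornerMXaddC.
have -> : q.[x] * x + c - (q.[y] * y + c)
        = (x * (q.[x] - q.[y])) + (q.[y] * (x - y)) by ring.
apply: le_trans (nrmD _ _) _; rewrite !nrmM mulrDl -mulrA.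
by rewrite lerD// ler_pM ?nrm_ge0 ?hM ?hN.
Qed.

(** [p] differs from its linear part at [z] by a quadratic error, uniformly on
    bounded sets. Stated for the difference of two nearby points, it gives both
    the local expansion of [p] near [J] and the contraction of a Newton step. *)
Lemma poly_quad p (B : R) : 0 <= B ->
  exists2 M : R, 0 <= M & forall z x y, nrm z <= B -> nrm x <= B -> nrm y <= B ->
    nrm (p.[x] - p.[y] - p^`().[z] * (x - y)) <=
      M * (nrm (x - z) + nrm (y - z)) * nrm (x - y).
Proof.
move=> B0; elim/poly_ind: p => [|q c [M M0 hM]].
  by exists 0 => // z x y _ _ _; rewrite deriv0 !horner0 mul0r !subr0 nrm0 !mul0r.
have [N N0 hN] := poly_bound q^`() B0.
have [L L0 hL] := poly_lip q B0.
exists (B * M + N + L) => [|z x y hz hx hy].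
  by rewrite !addr_ge0// mulr_ge0.
rewrite !hornerMXaddC derivMXaddC hornerD hornerM hornerX.
have -> : q.[x] * x + c - (q.[y] * y + c) - (q.[z] + q^`().[z] * z) * (x - y)
   = x * (q.[x] - q.[y] - q^`().[z] * (x - y))
     + ((x - z) * q^`().[z] * (x - y) + (q.[y] - q.[z]) * (x - y)) by ring.
apply: le_trans (nrmD _ _) _.
apply: le_trans (lerD (lexx _) (nrmD _ _)) _; rewrite !nrmM.
have h1 : nrm x * nrm (q.[x] - q.[y] - q^`().[z] * (x - y)) <=
   B * (M * (nrm (x - z) + nrm (y - z)) * nrm (x - y)).
  by rewrite ler_pM ?nrm_ge0 ?hM.
have h2 : nrm (x - z) * nrm (q^`().[z]) * nrm (x - y) <=
    N * (nrm (x - z) + nrm (y - z)) * nrm (x - y).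
  rewrite ler_wpM2r ?nrm_ge0// mulrC ler_pM ?nrm_ge0 ?hN// lerDl nrm_ge0//.
have h3 : nrm (q.[y] - q.[z]) * nrm (x - y) <=
    L * (nrm (x - z) + nrm (y - z)) * nrm (x - y).
  rewrite ler_wpM2r ?nrm_ge0//; apply: le_trans (hL _ _ hy hz) _.
  by rewrite ler_wpM2l// lerDr nrm_ge0.
lra.
Qed.

Lemma horner_cvg p (T : Type) (F : set_system T) (FF : Filter F) (f : T -> C) z :
  f x @[x --> F] --> z -> p.[f x] @[x --> F] --> p.[z].
Proof.
move=> hf; elim/poly_ind: p => [|q c IH].
  by rewrite horner0; under eq_fun do rewrite horner0; exact: cvg_cst.
rewrite hornerMXaddC; under eq_fun do rewrite hornerMXaddC.
exact: (cvgD (cvgM IH hf) (cvg_cst _)).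
Qed.

Lemma horner_iter_cvg p n (T : Type) (F : set_system T) (FF : Filter F) (f : T -> C) z :
  f x @[x --> F] --> z -> iter n (horner p) (f x) @[x --> F] --> iter n (horner p) z.
Proof. move=> hf; elim: n => [|n IH]; [exact: hf|exact: horner_cvg]. Qed.

Lemma horner_iter_near p n z (e : R) : 0 < e ->
  exists2 h : R, 0 < h & forall w, nrm (z - w) < h ->
    nrm (iter n (horner p) z - iter n (horner p) w) < e.
Proof.
move=> e0; apply/nbhs_nrm.
have h := @horner_iter_cvg p n C (nbhs z) (nbhs_filter z) id z (fun P hP => hP).
exact: ((cvg_nrm _ _ _).1 h e e0).
Qed.

Lemma poly_size_bound n q : (size q <= n.+1)%N ->
  exists2 M : R, 0 <= M & forall z, 1 <= nrm z -> nrm q.[z] <= M * nrm z ^+ n.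
Proof.
elim: n q => [|n IH] q.
  move/size1_polyC => ->; exists (nrm q`_0); first exact: nrm_ge0.
  by move=> z _; rewrite hornerC expr0 mulr1.
elim/poly_ind: q => [|q c _] hs.
  by exists 0 => // z _; rewrite horner0 nrm0 mul0r.
have [M M0 hM] : exists2 M : R, 0 <= M &
    forall z, 1 <= nrm z -> nrm q.[z] <= M * nrm z ^+ n.
  apply: IH; move: hs; rewrite size_MXaddC; case: ifP => [/andP[/eqP-> _]|_ //].
  by rewrite size_poly0.
exists (M + nrm c) => [|z hz]; first by rewrite addr_ge0 ?nrm_ge0.
rewrite hornerMXaddC; apply: le_trans (nrmD _ _) _; rewrite mulrDl nrmM.
apply: lerD.
  by rewrite exprSr mulrA ler_wpM2r ?nrm_ge0 ?hM.
by rewrite ler_peMr ?nrm_ge0// exprn_ege1.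
Qed.

Lemma poly_escape p d (B : R) : (2 <= d)%N -> size p = d.+1 -> p \is monic ->
  exists R0 : R, [/\ 1 <= R0, B <= R0 &
    forall z, R0 <= nrm z -> 2 * nrm z <= nrm p.[z]].
Proof.
move=> d2 sp mp.
case: d d2 sp => [//|[//|d]] _ sp.
pose q := p - 'X^(d.+2).
have hq : (size q <= d.+2)%N.
  apply/leq_sizeP => j; rewrite leq_eqVlt => /orP[/eqP <-|hj].
    rewrite coefB coefXn eqxx; move: mp; rewrite monicE lead_coefE sp /=.
    by move=> /eqP ->; rewrite subrr.
  by rewrite coefB coefXn gtn_eqF// nth_default ?subrr// sp.
have [M M0 hM] := poly_size_bound hq.
exists (M + 2 + Num.max B 0); have mx : 0 <= Num.max B 0 by rewrite le_max lexx orbT.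
have mB : B <= Num.max B 0 by rewrite le_max lexx.
split; [lra|lra|move=> z hz].
have z1 : 1 <= nrm z by lra.
have -> : p = 'X^(d.+2) + q by rewrite /q addrC subrK.
rewrite hornerD hornerXn.
have := nrm_lb (z ^+ d.+2) (- q.[z]); rewrite nrmN opprK nrmX => h.
apply: le_trans h.
have h2 := hM _ z1.
apply: (@le_trans _ _ (nrm z ^+ d.+1 * (nrm z - M))); last first.
  by rewrite [nrm z ^+ d.+2]exprSr mulrBr [_ * M]mulrC; lra.
rewrite mulrC; apply: ler_pM; [exact: nrm_ge0|lra| |lra].
by rewrite exprS ler_peMr ?nrm_ge0// exprn_ege1.
Qed.

Lemma prod_nrm_gt (s : seq C) (x : C) (d : nat) (t : R) : 0 <= t ->
  (forall r, r \in s -> t < nrm (x - r) ^+ d) -> s != [::] ->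
  t ^+ size s < nrm (\prod_(r <- s) (x - r)) ^+ d.
Proof.
move=> t0; elim: s => // r [|r' s] IH h _.
  by rewrite big_seq1 expr1 h ?mem_seq1.
rewrite big_cons nrmM exprMn exprS; apply: ltr_pM => //; first exact: exprn_ge0.
  by rewrite h ?mem_head.
by apply: IH => // u hu; rewrite h// in_cons hu orbT.
Qed.

(** The product of the distances from [x] to the [d] roots of [p - w] is
    [|p(x) - w|], so one of them is at most its [d]-th root. This is the open
    mapping property of [p] in quantitative form. *)
Lemma poly_root_near p d : (0 < d)%N -> size p = d.+1 -> p \is monic ->
  forall x w, exists2 w', p.[w'] = w & nrm (x - w') ^+ d <= nrm (p.[x] - w).
Proof.
move=> d0 sp mp x w.
have sq : size (p - w%:P) = d.+1.
  by rewrite size_polyDl// size_polyN sp ltnS (leq_trans (size_polyC_leq1 _)).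
have mq : p - w%:P \is monic.
  rewrite monicE lead_coefDl -?monicE// size_polyN sp ltnS.
  by rewrite (leq_trans (size_polyC_leq1 _)).
have [s hs] := closed_field_poly_normal (p - w%:P).
move: hs; rewrite (monicP mq) scale1r => hs.
have ss : size s = d by apply/eqP; rewrite -eqSS -sq hs size_prod_XsubC.
apply: contrapT => hn.
have hr r : r \in s -> p.[r] = w.
  move=> rs; have : root (p - w%:P) r by rewrite hs root_prod_XsubC.
  by rewrite rootE hornerD hornerN hornerC subr_eq0 => /eqP.
have : nrm (p.[x] - w) ^+ size s < nrm (\prod_(r <- s) (x - r)) ^+ d.
  apply: prod_nrm_gt; [exact: nrm_ge0| |by rewrite -size_eq0 ss -lt0n].
  move=> r rs; rewrite ltNge; apply/negP => h; apply: hn.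
  by exists r => //; exact: hr.
have -> : \prod_(r <- s) (x - r) = p.[x] - w.
  have : (p - w%:P).[x] = p.[x] - w by rewrite hornerD hornerN hornerC.
  rewrite hs horner_prod => <-; apply: eq_bigr => r _.
  by rewrite hornerXsubC.
by rewrite ss ltxx.
Qed.

Lemma prim_root_exists n : (0 < n)%N -> exists z : C, n.-primitive_root z.
Proof.
move=> n0; pose p : {poly C} := 'X^n - 1.
have [s hs] := closed_field_poly_normal p.
have mp : p \is monic by rewrite /p monicXnsubC.
move: hs; rewrite (monicP mp) scale1r => hs.
have rn : all n.-unity_root s.
  by apply/allP => z zs; rewrite /root_of_unity -/p hs root_prod_XsubC.
have sz : size s = n by apply/eqP; rewrite -eqSS -(size_prod_XsubC s id) -hs size_XnsubC.
have us : uniq s.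
  rewrite -separable_prod_XsubC -hs separable_Xn_sub_1//.
  by rewrite pnatr_eq0 -lt0n.
have /hasP[z _ hz] : has n.-primitive_root s by rewrite has_prim_root ?sz.
by exists z.
Qed.

Lemma prim_root_nrm1 n (z : C) : n.-primitive_root z -> nrm z = 1.
Proof.
move=> hz; apply/eqP; rewrite -(@pexpr_eq1 _ _ n) ?nrm_ge0//.
  by rewrite -nrmX prim_expr_order// nrm1.
exact: prim_order_gt0 hz.
Qed.

(** The linear coefficient of [f] at [x] is an average of the values of [f] on the
    circle of radius [rho], weighted by inverses of roots of unity of an order
    exceeding the degree. *)
Lemma cauchy_estimate (f : {poly C}) x (rho M : R) : 0 < rho ->
  (forall z, nrm (z - x) <= rho -> nrm f.[z] <= M) ->
  rho * nrm f^`().[x] <= M.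
Proof.
move=> rho0 hM.
pose g := f \Po ('X + x%:P).
have g1 : g`_1 = f^`().[x].
  have : g^`().[0] = f^`().[x].
    by rewrite deriv_comp derivD derivX derivC addr0 mulr1 horner_comp !hornerE.
  by rewrite horner_coef0 coef_deriv.
have [n sn n1] : exists2 n, (size g <= n)%N & (1 < n)%N.
  by exists (size g).+2; rewrite // -addn2 leq_addr.
have [w hw] := prim_root_exists (ltnW n1).
have w0 : w != 0 by rewrite -nrm_gt0 (prim_root_nrm1 hw).
(* only the coefficient of degree 1 survives the average *)
have key : \sum_(j < n) w ^- j * g.[rho%:C * w ^+ j] = n%:R * (rho%:C * g`_1).
  transitivity (\sum_(j < n) \sum_(k < n) w ^- j * (g`_k * (rho%:C * w ^+ j) ^+ k)).
    by apply: eq_bigr => j _; rewrite (horner_coef_wide _ sn) mulr_sumr.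
  rewrite exchange_big (bigD1 (Ordinal n1))//= [X in _ + X]big1 ?addr0.
    rewrite (eq_bigr (fun=> rho%:C * g`_1)).
      by rewrite sumr_const card_ord mulr_natl.
    move=> j _; rewrite expr1 mulrCA !mulrA [_ / _ * _]mulrC; field.
    by rewrite expf_neq0.
  move=> k hk.
  have -> : \sum_(i < n) w ^- i * (g`_k * (rho%:C * w ^+ i) ^+ k)
     = g`_k * rho%:C ^+ k * \sum_(i < n) (w ^+ k / w) ^+ i.
    rewrite mulr_sumr; apply: eq_bigr => i _; rewrite !exprMn exprVn.
    by rewrite -!exprM [(i * k)%N]mulnC; ring.
  have : (w ^+ k / w) ^+ n - 1 = 0.
    by rewrite exprMn exprVn -exprM mulnC exprM (prim_expr_order hw) expr1n invr1 mulr1 subrr.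
  rewrite subrX1 => /eqP; rewrite mulf_eq0 => /orP[|/eqP ->]; last by rewrite mulr0.
  rewrite subr_eq0 => /eqP h; exfalso.
  have : w ^+ k == w ^+ 1 by rewrite expr1 -[X in _ == X]mul1r -h divfK.
  rewrite (eq_prim_root_expr hw) !modn_small// => /eqP h1.
  by move/eqP: hk; apply; apply: val_inj.
have n0 : 0 < (n%:R : R) by rewrite ltr0n ltnW.
rewrite -(ler_pM2l n0) -g1.
have -> : n%:R * (rho * nrm g`_1) = nrm (n%:R * (rho%:C * g`_1)).
  by rewrite !nrmM nrm_nat nrm_real gtr0_norm.
rewrite -key; apply: le_trans (nrm_sum _ _ _) _.
rewrite mulr_natl -[X in _ *+ X]card_ord -sumr_const; apply: ler_sum => j _.
rewrite nrmM nrmV nrmX (prim_root_nrm1 hw) expr1n invr1 mul1r.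
rewrite horner_comp !hornerE; apply: hM.
by rewrite addrK nrmM nrmX (prim_root_nrm1 hw) expr1n mulr1 nrm_real gtr0_norm.
Qed.

End Polynomials.

(** * Compactness, frontiers and bounded orbits *)

Section Topology.
Variable R : realType.
Local Notation C := (Cplx R).
Implicit Types (z w x : C).

(** Heine-Borel, transported from the square of a real segment. *)
Lemma compact_nrm (A : set C) (B : R) : closed A ->
  (forall z, A z -> nrm z <= B) -> compact A.
Proof.
move=> cA hB.
pose f (ab : R * R) : C := (ab.1 +i* ab.2)%C.
have cf : continuous f.
  move=> [a b]; apply/cvg_nrm => e e0.
  have e20 : 0 < e / 2 by lra.
  near=> ab.
  apply: le_lt_trans (nrm_ReIm _) _; rewrite ReB ImB /=.
  have h1 : `|a - ab.1| < e / 2.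
    near: ab; apply: (@cvgr_dist_lt _ _ _ _ _ (fun ab : R * R => ab.1) a) => //.
    exact: (@cvg_fst _ _ (nbhs a) (nbhs b)).
  have h2 : `|b - ab.2| < e / 2.
    near: ab; apply: (@cvgr_dist_lt _ _ _ _ _ (fun ab : R * R => ab.2) b) => //.
    exact: (@cvg_snd _ _ (nbhs a) (nbhs b)).
  lra.
have cK : compact (f @` (`[- B, B] `*` `[- B, B])).
  apply: continuous_compact; first exact: continuous_subspaceT.
  by apply: compact_setX; apply: segment_compact.
apply: subclosed_compact cA cK _ => z Az.
exists (complex.Re z, complex.Im z); last by case: (z).
split; rewrite /= in_itv /= -ler_norml.
  exact: le_trans (nrm_Re z) (hB _ Az).
exact: le_trans (nrm_Im z) (hB _ Az).
Unshelve. all: by end_near. Qed.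

Lemma compact_uniform_index (A : set C) (P : nat -> C -> Prop) :
  compact A -> (forall n, open (P n)) ->
  (forall m n z, (m <= n)%N -> P m z -> P n z) ->
  (forall z, A z -> exists n, P n z) -> exists n, forall z, A z -> P n z.
Proof.
rewrite compact_cover => cA oP mono cov.
have [|D _ hD] := cA nat setT (fun n => P n : set C) (fun n _ => oP n).
  by move=> z /cov [n hn]; exists n.
exists (\max_(i <- finmap.enum_fset D) i)%N => z /hD [i iD].
by apply: mono; apply: leq_bigmax_seq.
Qed.

Lemma frontierP (A : set C) z : frontier A z <->
  forall e : R, 0 < e -> (exists2 w, nrm (z - w) < e & A w) /\
                         (exists2 w, nrm (z - w) < e & ~ A w).
Proof.
split=> [[cz iz] e e0|h].
  split.
    have [|w [Aw hw]] := cz [set w | nrm (z - w) < e].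
      by apply/nbhs_nrm; exists e.
    by exists w.
  apply: contrapT => hn; apply: iz; apply/nbhs_nrm; exists e => // w hw.
  by apply: contrapT => nA; apply: hn; exists w.
split=> [B /nbhs_nrm [e e0 he]|/nbhs_nrm [e e0 he]].
  by have [[w hw Aw] _] := h e e0; exists w; split=> //; apply: he.
by have [_ [w hw]] := h e e0; apply; apply: he.
Qed.

(** The supremum of the parameters of points in [A] gives a frontier point. *)
Lemma segment_frontier (A : set C) x y : A x -> ~ A y ->
  exists2 t : R, 0 <= t <= 1 & frontier A (x + t%:C * (y - x)).
Proof.
move=> Ax nAy.
pose zz (t : R) : C := x + t%:C * (y - x).
have zd s t : nrm (zz s - zz t) = `|s - t| * nrm (y - x).
  have -> : zz s - zz t = (s - t)%:C * (y - x) by rewrite /zz rmorphB /=; ring.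
  by rewrite nrmM nrm_real.
pose E := [set t : R | 0 <= t <= 1 /\ A (zz t)].
have E0 : E 0 by split; rewrite ?lexx ?ler01// /zz mul0r addr0.
have Eb : has_sup E by split; [exists 0|exists 1 => t [/andP[]]].
have s1 : sup E <= 1 by apply: ge_sup; [exists 0|move=> t [/andP[]]].
have s0 : 0 <= sup E by apply: ub_le_sup; [exact: Eb.2|].
exists (sup E); first by rewrite s0 s1.
have L0 : 0 <= nrm (y - x) by exact: nrm_ge0.
have L1 : 0 < nrm (y - x) + 1 by lra.
apply/frontierP => e e0.
pose h := e / (nrm (y - x) + 1).
have h0 : 0 < h by apply: divr_gt0.
have hL : h * nrm (y - x) < e.
  have : h * (nrm (y - x) + 1) = e by rewrite /h divfK// gt_eqF.
  by rewrite mulrDr mulr1; lra.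
split.
  have [t [t01 At] ht] := sup_adherent h0 Eb.
  exists (zz t) => //; rewrite -/(zz _) zd; apply: le_lt_trans hL.
  rewrite ler_wpM2r//.
  have ts : t <= sup E by apply: ub_le_sup; [exact: Eb.2|].
  by rewrite ger0_norm; lra.
apply: contrapT => hn.
have hA t : `|sup E - t| <= h -> A (zz t).
  move=> ht; apply: contrapT => nA; apply: hn; exists (zz t) => //.
  by rewrite -/(zz _) zd; apply: le_lt_trans hL; rewrite ler_wpM2r.
have [s_lt1|s_ge1] := ltP (sup E) 1; last first.
  have /hA : `|sup E - 1| <= h by rewrite (_ : sup E = 1) ?subrr ?normr0; lra.
  by rewrite /zz mul1r addrC subrK.
pose t := Num.min 1 (sup E + h).
have ts : sup E < t by rewrite lt_min s_lt1 ltrDl.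
have t1 : t <= 1 by rewrite ge_min lexx.
have th : t <= sup E + h by rewrite ge_min lexx orbT.
have : E t.
  split; first by apply/andP; split; lra.
  by apply: hA; rewrite distrC ger0_norm; lra.
by move/(ub_le_sup Eb.2); lra.
Qed.

Lemma bounded_orbitP (V : pseudoMetricNormedZmodType C) (f : V -> V) (v : V) :
  bounded_orbit f v <-> exists B : R, forall n, `|iter n f v| <= B%:C.
Proof.
split=> [[M [Mr hM]]|[B hB]].
  have Mr' : M = (complex.Re M)%:C by rewrite RRe_real.
  exists (complex.Re M + 1) => n; apply: hM; last by exists n.
  by rewrite Mr' ltcR; lra.
exists B%:C; split=> [|x hx].
  by apply/complex_realP; exists B.
by move=> _ [n _ <-]; apply: le_trans (hB n) (ltW hx).
Qed.

Lemma pair_norm_le (v : C * C) (B : R) :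
  (`|v| <= B%:C) = (nrm v.1 <= B) && (nrm v.2 <= B).
Proof.
by rewrite prod_normE /= !normE comparable_ge_max ?lecR// real_comparable//;
  apply/complex_realP; eexists.
Qed.

End Topology.

(** * The Julia set and its adapted metric *)

Section JuliaSet.
Variables (R : realType) (d : nat) (p : {poly Cplx R}).
Hypotheses (d_ge2 : (2 <= d)%N) (p_deg : size p = d.+1) (p_monic : p \is monic).
Local Notation C := (Cplx R).
Implicit Types (z w x : C).

Lemma filled_Julia_orbitP z :
  filled_Julia p z <-> exists B : R, forall n, nrm (iter n (horner p) z) <= B.
Proof.
rewrite /filled_Julia /= bounded_orbitP; split=> -[B hB]; exists B => n;
  by have := hB n; rewrite normE lecR.
Qed.

Lemma filled_Julia_horner z : filled_Julia p p.[z] <-> filled_Julia p z.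
Proof.
rewrite !filled_Julia_orbitP; split=> -[B hB].
  exists (Num.max B (nrm z)) => -[|n]; first by rewrite le_max lexx orbT.
  by rewrite iterSr le_max hB.
by exists B => n; rewrite -iterSr.
Qed.

Lemma escape_iter (R0 : R) : 1 <= R0 ->
  (forall z, R0 <= nrm z -> 2 * nrm z <= nrm p.[z]) ->
  forall n z, R0 < nrm z -> R0 < nrm (iter n (horner p) z).
Proof.
move=> R1 hR n z hz; elim: n => //= n IH.
by have := hR _ (ltW IH); lra.
Qed.

(** Once outside the escape disk the modulus at least doubles at each step. *)
Lemma filled_Julia_escape (R0 : R) : 1 <= R0 ->
  (forall z, R0 <= nrm z -> 2 * nrm z <= nrm p.[z]) ->
  forall z, filled_Julia p z <-> forall n, nrm (iter n (horner p) z) <= R0.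
Proof.
move=> R1 hR z; rewrite filled_Julia_orbitP; split; last by exists R0.
move=> [B hB] n; rewrite leNgt; apply/negP => hn.
set x := iter n (horner p) z in hn.
have hx m : m%:R <= nrm (iter m (horner p) x).
  elim: m => [|m IH]; first exact: nrm_ge0.
  have hm := escape_iter R1 hR m hn.
  have := hR _ (ltW hm) => /=; rewrite -natr1; lra.
have B0 : 0 <= B by apply: le_trans (hB 0%N); exact: nrm_ge0.
have := hx (Num.truncn B).+1; rewrite /x -iterD => h.
have := le_trans h (hB _); rewrite leNgt => /negP; apply.
by have /andP[] := truncn_itv B0.
Qed.

Lemma filled_Julia_closed : closed (filled_Julia p).
Proof.
have [R0 [R1 _ hR]] := poly_escape 0 d_ge2 p_deg p_monic.
apply/closed_nrm => z hz; rewrite (filled_Julia_escape R1 hR) => n.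
apply/ler_addgt0Pr => e e0.
have [h h0 hh] := horner_iter_near p n z e0.
have [w Kw hw] := hz h h0.
have := hh _ hw; move/(filled_Julia_escape R1 hR): Kw => /(_ n).
have := nrm_lb (iter n (horner p) z) (iter n (horner p) w); lra.
Qed.

Lemma Julia_sub_filled z : Julia p z -> filled_Julia p z.
Proof. by case=> /filled_Julia_closed. Qed.

Lemma Julia_closed : closed (Julia p).
Proof.
apply/closed_nrm => z hz; apply/frontierP => e e0.
have e20 : 0 < e / 2 by lra.
have [w /frontierP /(_ _ e20) [[u hu Ku] [v hv Kv]] hw] := hz _ e20.
split; [exists u => //|exists v => //].
  by have := nrm_tri w z u; lra.
by have := nrm_tri w z v; lra.
Qed.

(** Backward invariance uses that [p] is open, through [poly_root_near]. *)
Lemma Julia_horner z : Julia p p.[z] <-> Julia p z.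
Proof.
split=> h; apply/frontierP => e e0.
  have [Kz _] : filled_Julia p p.[z] /\ True by split=> //; apply: Julia_sub_filled.
  split; first by exists z; rewrite ?subrr ?nrm0//; apply/filled_Julia_horner.
  have [_ [w hw Kw]] := (frontierP _ _).1 h (e ^+ d) (exprn_gt0 _ e0).
  have [w' pw' hw'] := poly_root_near (ltnW d_ge2) p_deg p_monic z w.
  exists w'; last by rewrite -filled_Julia_horner pw'.
  rewrite -(@ltr_pXn2r _ d) ?nnegrE ?nrm_ge0 ?(ltW e0)//; last exact: ltnW.
  exact: le_lt_trans hw' hw.
split.
  exists p.[z]; first by rewrite subrr nrm0.
  by apply/filled_Julia_horner; apply: Julia_sub_filled.
have [h' h0 hh] := horner_iter_near p 1 z e0.
have [_ [w hw Kw]] := (frontierP _ _).1 h _ h0.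
exists p.[w]; first exact: hh.
by rewrite filled_Julia_horner.
Qed.

Lemma Julia_iter n z : Julia p z -> Julia p (iter n (horner p) z).
Proof. move=> Jz; elim: n => [|n IH]; [exact: Jz|exact/Julia_horner]. Qed.

Lemma Julia_bounded : exists2 B : R, 0 <= B & forall z, Julia p z -> nrm z <= B.
Proof.
have [R0 [R1 _ hR]] := poly_escape 0 d_ge2 p_deg p_monic.
exists R0; first lra.
by move=> z /Julia_sub_filled /(filled_Julia_escape R1 hR) /(_ 0%N).
Qed.

Lemma horner_iter_poly n z : (iter_poly p n).[z] = iter n (horner p) z.
Proof.
elim: n => [|n IH]; first by rewrite hornerX.
by rewrite /iter_poly iterS horner_comp IH.
Qed.

Lemma deriv_iter_polyS n z : (iter_poly p n.+1)^`().[z] =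
  p^`().[iter n (horner p) z] * (iter_poly p n)^`().[z].
Proof. by rewrite /iter_poly iterS deriv_comp hornerM horner_comp horner_iter_poly. Qed.

(** The recursive definition differentiates the last factor; the adapted metric
    needs the first one, in order to compare [z] with [p z]. *)
Lemma deriv_iter_polySr n z : (iter_poly p n.+1)^`().[z] =
  (iter_poly p n)^`().[p.[z]] * p^`().[z].
Proof.
elim: n => [|n IH]; first by rewrite deriv_iter_polyS /iter_poly /= derivX !hornerC mulrC.
by rewrite deriv_iter_polyS IH [in RHS]deriv_iter_polyS -iterSr mulrA.
Qed.

End JuliaSet.

(** The constants of the adapted metric of a hyperbolic polynomial, together with
    a radius [del] within which [p] is close enough to its linear part for the
    expansion to persist. *)
Record expanding_metric (R : realType) (p : {poly Cplx R})
    (sig : Cplx R -> R) (mu S del : R) : Prop := ExpandingMetric {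
  em_mu : 1 < mu;
  em_S : 1 <= S;
  em_del : 0 < del <= 1;
  em_ge1 : forall z, 1 <= sig z;
  em_leS : forall z, Julia p z -> sig z <= S;
  em_expand : forall z, Julia p z -> mu * sig z <= sig p.[z] * nrm p^`().[z];
  em_quad : forall z x y, Julia p z -> nrm (x - z) <= del -> nrm (y - z) <= del ->
    sig p.[z] * nrm (p.[x] - p.[y] - p^`().[z] * (x - y)) <=
      (mu - 1) / 2 * (sig z * nrm (x - y));
  em_deriv : forall z x, Julia p z -> nrm (x - z) <= del ->
    (mu + 1) / 2 * sig z <= sig p.[z] * nrm p^`().[x] }.

Section AdaptedMetric.
Variables (R : realType) (d : nat) (p : {poly Cplx R}).
Hypotheses (d_ge2 : (2 <= d)%N) (p_deg : size p = d.+1) (p_monic : p \is monic).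
Local Notation C := (Cplx R).
Implicit Types (z w x : C).

(** The weight is the truncated series [sum_(k < N) |(p^k)'(z)| mu^-k], with [mu]
    strictly between [1] and the hyperbolicity rate. Going from [z] to [p z] shifts
    the sum by one term: the term [k = 0] that is lost equals [1], and the term
    [k = N] that is gained is at least [1] as soon as [N] is large. *)
Lemma adapted_metric : hyperbolic p ->
  exists (sig : C -> R) (mu S : R), [/\ 1 < mu, 1 <= S, (forall z, 1 <= sig z),
    (forall z, Julia p z -> sig z <= S) &
    forall z, Julia p z -> mu * sig z <= sig p.[z] * nrm p^`().[z]].
Proof.
move=> [U [_ JU [c [lambda [c0 l1 hexp]]]]].
have JUi n z : Julia p z -> c * lambda ^+ n <= nrm (iter_poly p n)^`().[z].
  move=> Jz; have := hexp n z; rewrite normE lecR; apply=> k _.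
  by apply: JU; apply: (Julia_iter d_ge2 p_deg p_monic).
(* strictly below lambda, so that a large N makes up for the constant c *)
pose mu := (1 + lambda) / 2.
have mu1 : 1 < mu by rewrite /mu; lra.
have mu0 : 0 < mu by lra.
have [N0 hN0] : exists n, 1 < c * (lambda / mu) ^+ n.
  by apply: geometric_exceeds => //; rewrite ltr_pdivlMr// /mu; lra.
pose N := N0.+1.
have hN : mu ^+ N <= c * lambda ^+ N.
  have : 1 * mu ^+ N <= c * (lambda / mu) ^+ N * mu ^+ N.
    rewrite ler_pM2r ?exprn_gt0//; apply: le_trans (ltW hN0) _.
    rewrite ler_pM2l// /N exprS ler_peMl ?exprn_ge0//; first by rewrite divr_ge0//; lra.
    by rewrite ler_pdivlMr// /mu; lra.
  have -> : c * (lambda / mu) ^+ N * mu ^+ N = c * lambda ^+ N.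
    by rewrite -mulrA -exprMn divfK// gt_eqF.
  by rewrite mul1r.
have [B B0 hB] := Julia_bounded d_ge2 p_deg p_monic.
pose D n z := nrm (iter_poly p n)^`().[z].
pose sig z := \sum_(k < N) D k z * mu ^- k.
have muk k : 0 < mu ^- k by rewrite invr_gt0 exprn_gt0.
have sig_ge1 z : 1 <= sig z.
  rewrite /sig big_ord_recl /= /D /iter_poly /= derivX hornerC nrm1 expr0 invr1 mulr1.
  by rewrite lerDl sumr_ge0// => k _; rewrite mulr_ge0 ?nrm_ge0 ?ltW.
have [S hS] : exists S : R, forall z, nrm z <= B -> sig z <= S.
  rewrite /sig; elim: (N) => [|n [S hS]].
    by exists 0 => z _; rewrite big_ord0.
  have [M M0 hM] := poly_bound (iter_poly p n)^`() B0.
  exists (S + M * mu ^- n) => z hz; rewrite big_ord_recr /= lerD ?hS//.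
  by rewrite ler_pM2r// hM.
pose S1 := Num.max 1 S.
have S11 : 1 <= S1 by rewrite le_max lexx.
have SS1 : S <= S1 by rewrite le_max lexx orbT.
have JS z : Julia p z -> sig z <= S1 by move=> /hB /hS h; apply: le_trans h SS1.
have sexp z : Julia p z -> mu * sig z <= sig p.[z] * nrm p^`().[z].
  move=> Jz.
  have e1 : sig p.[z] * nrm p^`().[z] = \sum_(k < N) D k.+1 z * mu ^- k.
    rewrite /sig mulr_suml; apply: eq_bigr => k _.
    by rewrite /D (deriv_iter_polySr p) nrmM mulrAC.
  (* the same sum of N + 1 terms split at its last and at its first term *)
  have e2 : sig z + D N z * mu ^- N = D 0%N z + \sum_(k < N) D k.+1 z * mu ^- k.+1.
    transitivity (\sum_(k < N.+1) D k z * mu ^- k); first by rewrite big_ord_recr.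
    by rewrite big_ord_recl expr0 invr1 mulr1.
  have e3 : \sum_(k < N) D k.+1 z * mu ^- k = mu * \sum_(k < N) D k.+1 z * mu ^- k.+1.
    rewrite mulr_sumr; apply: eq_bigr => k _; rewrite exprS invfM; field.
    by rewrite expf_neq0 gt_eqF.
  have D0 : D 0%N z = 1 by rewrite /D /iter_poly /= derivX hornerC nrm1.
  have hD : 1 <= D N z * mu ^- N.
    by rewrite ler_pdivlMr ?exprn_gt0// mul1r; apply: le_trans hN (JUi _ _ Jz).
  by rewrite e1 e3 ler_pM2l//; lra.
by exists sig, mu, S1; split.
Qed.

Lemma hyperbolic_metric : hyperbolic p ->
  exists (sig : C -> R) (mu S del : R), expanding_metric p sig mu S del.
Proof.
move=> /adapted_metric [sig [mu [S1 [mu1 S11 sig_ge1 JS sexp]]]].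
have [B B0 hB] := Julia_bounded d_ge2 p_deg p_monic.
have B10 : 0 <= B + 1 by lra.
have [M M0 hM] := poly_quad p B10.
have [L L0 hL] := poly_lip p^`() B10.
pose T := M + M + L + 1.
have T0 : 0 < T by rewrite /T; lra.
pose del := Num.min 1 ((mu - 1) / 2 / (S1 * T)).
have ST0 : 0 < S1 * T by apply: mulr_gt0; lra.
have del0 : 0 < del.
  by rewrite lt_min ltr01 /=; apply: divr_gt0 => //; lra.
have del1 : del <= 1 by rewrite ge_min lexx.
have delT : S1 * T * del <= (mu - 1) / 2.
  by rewrite mulrC -ler_pdivlMr// ge_min lexx orbT.
have near z x : Julia p z -> nrm (x - z) <= del -> nrm x <= B + 1.
  by move=> /hB hz hx; have := nrm_lb x z; lra.
exists sig, mu, S1, del.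
apply: (ExpandingMetric mu1 S11 _ sig_ge1 JS sexp).
- by rewrite del0.
- move=> z x y Jz hx hy.
  have nx := near _ _ Jz hx; have ny := near _ _ Jz hy.
  have nz : nrm z <= B + 1 by have := hB _ Jz; lra.
  have h := hM z x y nz nx ny.
  have xy0 := nrm_ge0 (x - y).
  have h2 : M * (nrm (x - z) + nrm (y - z)) * nrm (x - y) <= T * del * nrm (x - y).
    rewrite ler_wpM2r// /T.
    have : M * (nrm (x - z) + nrm (y - z)) <= M * (del + del) by rewrite ler_wpM2l// lerD.
    have : 0 <= (L + 1) * del by rewrite mulr_ge0; lra.
    lra.
  have pJ : Julia p p.[z] by apply/(Julia_horner d_ge2 p_deg p_monic).
  apply: (@le_trans _ _ (S1 * (T * del * nrm (x - y)))).
    apply: ler_pM; [have := sig_ge1 p.[z]; lra|exact: nrm_ge0|exact: JS|].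
    exact: le_trans h h2.
  rewrite !mulrA; apply: (@le_trans _ _ ((mu - 1) / 2 * nrm (x - y))).
    by rewrite ler_wpM2r.
  rewrite -[leRHS]mulrA; apply: ler_wpM2l; first lra.
  by rewrite ler_peMl.
- move=> z x Jz hx.
  have nx := near _ _ Jz hx.
  have nz : nrm z <= B + 1 by have := hB _ Jz; lra.
  have h := hL x z nx nz.
  have h2 : L * nrm (x - z) <= T * del.
    by rewrite ler_pM ?nrm_ge0// /T; lra.
  have pJ : Julia p p.[z] by apply/(Julia_horner d_ge2 p_deg p_monic).
  have h3 := nrm_lb (p^`().[z]) (p^`().[z] - p^`().[x]); rewrite subKr nrmBC in h3.
  have sp1 := sig_ge1 p.[z].
  have h4 : sig p.[z] * (nrm p^`().[z] - T * del) <= sig p.[z] * nrm p^`().[x].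
    by rewrite ler_wpM2l; lra.
  apply: le_trans h4; rewrite mulrBr.
  have h5 : sig p.[z] * (T * del) <= (mu - 1) / 2.
    apply: le_trans delT; rewrite -mulrA ler_wpM2r ?JS//.
    by apply: mulr_ge0; lra.
  have h6 : (mu - 1) / 2 <= (mu - 1) / 2 * sig z by rewrite ler_peMr//; lra.
  by have := sexp _ Jz; lra.
Qed.

End AdaptedMetric.

#[local] Opaque Julia filled_Julia.

(** * Expansion, pull-back and shadowing near the Julia set *)

(** Distance to the Julia set measured with the weight at the point of the Julia
    set, because that is the quantity which [p] expands. *)
Definition Julia_near (R : realType) (p : {poly Cplx R}) (sig : Cplx R -> R)
    (t : R) (x : Cplx R) : Prop :=
  exists2 w, Julia p w & sig w * nrm (x - w) <= t.

Section Expansion.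
Variables (R : realType) (d : nat) (p : {poly Cplx R}).
Hypotheses (d_ge2 : (2 <= d)%N) (p_deg : size p = d.+1) (p_monic : p \is monic).
Variables (sig : Cplx R -> R) (mu S del : R).
Hypothesis em : expanding_metric p sig mu S del.
Local Notation C := (Cplx R).
Local Notation J := (Julia p).
Local Notation near := (Julia_near p sig).
Local Notation it n z := (iter n (horner p) z).
Implicit Types (z w x y : C).

Let mu1 : 1 < mu. Proof. exact: em_mu em. Qed.
Let S1 : 1 <= S. Proof. exact: em_S em. Qed.
Let del0 : 0 < del. Proof. by have /andP[] := em_del em. Qed.
Let del1 : del <= 1. Proof. by have /andP[] := em_del em. Qed.

Lemma sig_gt0 z : 0 < sig z.
Proof. exact: lt_le_trans ltr01 (em_ge1 em z). Qed.

Lemma nrm_le_sig z x : nrm x <= sig z * nrm x.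
Proof. by rewrite ler_peMl ?nrm_ge0// (em_ge1 em). Qed.

Lemma sig_le_nrm z x : J z -> sig z * nrm x <= S * nrm x.
Proof. by move=> Jz; rewrite ler_wpM2r ?nrm_ge0// (em_leS em). Qed.

Lemma Julia_step z : J z -> J p.[z].
Proof. by move/(Julia_horner d_ge2 p_deg p_monic). Qed.

Lemma expand_local z x y : J z -> nrm (x - z) <= del -> nrm (y - z) <= del ->
  (mu + 1) / 2 * (sig z * nrm (x - y)) <= sig p.[z] * nrm (p.[x] - p.[y]).
Proof.
move=> Jz hx hy.
have h1 := em_quad em Jz hx hy.
have h2 : mu * (sig z * nrm (x - y)) <= sig p.[z] * nrm (p^`().[z] * (x - y)).
  by rewrite nrmM !mulrA ler_wpM2r ?nrm_ge0// (em_expand em).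
have h3 : sig p.[z] * nrm (p^`().[z] * (x - y)) <=
  sig p.[z] * nrm (p.[x] - p.[y]) + sig p.[z] * nrm (p.[x] - p.[y] - p^`().[z] * (x - y)).
  rewrite -mulrDr ler_pM2l ?sig_gt0//.
  have -> : p^`().[z] * (x - y) = p.[x] - p.[y] - (p.[x] - p.[y] - p^`().[z] * (x - y)).
    by rewrite subKr.
  by rewrite {2}subKr nrmB.
move: h1 h2 h3; lra.
Qed.

(** Near [w] in [J] the map [p] has a contracting inverse branch along [J]:
    [poly_root_near] gives a first crude bound on a preimage, and the local
    expansion then improves it. *)
Lemma pullback w x : J w -> sig w * nrm (p.[x] - w) <= del ^+ d ->
  exists w', [/\ J w', p.[w'] = w &
    (mu + 1) / 2 * (sig w' * nrm (x - w')) <= sig w * nrm (p.[x] - w)].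
Proof.
move=> Jw hw.
have [w' pw' hw'] := poly_root_near (ltnW d_ge2) p_deg p_monic x w.
have xw : nrm (x - w') <= del.
  rewrite -(@ler_pXn2r _ d) ?nnegrE ?nrm_ge0 ?(ltW del0)//; last exact: ltnW.
  exact: le_trans hw' (le_trans (nrm_le_sig w _) hw).
have Jw' : J w' by rewrite -(Julia_horner d_ge2 p_deg p_monic) pw'.
exists w'; split=> //.
by have := expand_local Jw' xw; rewrite -pw'; apply; rewrite subrr nrm0 ltW.
Qed.

(** Read contrapositively, points that are away from [J] move further away. *)
Lemma near_pull t x : (mu + 1) / 2 * t <= del ^+ d ->
  near ((mu + 1) / 2 * t) p.[x] -> near t x.
Proof.
move=> ht [w Jw hw].
have [w' [Jw' _ h]] := pullback Jw (le_trans hw ht).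
exists w' => //.
have h2 := le_trans h hw; rewrite ler_pM2l in h2 => //; move: mu1; lra.
Qed.

Lemma near_shift t x y : near t x -> near (t + S * nrm (x - y)) y.
Proof.
move=> [w Jw hw]; exists w => //.
have h : sig w * nrm (y - w) <= sig w * (nrm (x - y) + nrm (x - w)).
  by rewrite ler_pM2l ?sig_gt0// [nrm (x - y)]nrmBC nrm_tri.
apply: le_trans h _; rewrite mulrDr addrC lerD//.
exact: sig_le_nrm.
Qed.

Lemma near_le s t x : s <= t -> near s x -> near t x.
Proof. by move=> st [w Jw hw]; exists w => //; apply: le_trans st. Qed.

(** The last point of the segment is near [J]; the contracting pull-backs carry a
    point of [J] back along the pseudo-orbit without loss. *)
Lemma shadowing_finite t : (mu + 1) / 2 * t <= del ^+ d ->
  forall N (x : nat -> C), (forall n, near t (x n)) ->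
  (forall n, S * nrm (p.[x n] - x n.+1) <= (mu - 1) / 2 * t) ->
  exists2 z, J z & forall n, (n <= N)%N -> sig (it n z) * nrm (x n - it n z) <= t.
Proof.
move=> ht; elim=> [|N IH] x hx hp.
  have [z Jz hz] := hx 0%N; exists z => // n; rewrite leqn0 => /eqP ->; exact: hz.
have [z Jz hz] := IH (fun n => x n.+1) (fun n => hx n.+1) (fun n => hp n.+1).
have h0 : sig z * nrm (p.[x 0%N] - z) <= (mu + 1) / 2 * t.
  have h1 : sig z * nrm (p.[x 0%N] - z) <=
      sig z * (nrm (p.[x 0%N] - x 1%N) + nrm (x 1%N - z)).
    by rewrite ler_pM2l ?sig_gt0// nrm_tri.
  have h2 : sig z * nrm (p.[x 0%N] - x 1%N) <= S * nrm (p.[x 0%N] - x 1%N).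
    exact: sig_le_nrm.
  have h3 := hz 0%N isT; have h4 := hp 0%N; rewrite /= in h3.
  rewrite mulrDr in h1; move: h1 h2 h3 h4; lra.
have [w [Jw pw hw]] := pullback Jz (le_trans h0 ht).
exists w => // -[_|n]; last first.
  by rewrite ltnS => /hz; rewrite iterSr pw.
have h5 := le_trans hw h0; rewrite ler_pM2l in h5 => //; move: mu1; lra.
Qed.

Lemma expand_orbit N z w : J z ->
  (forall n, (n < N)%N -> nrm (it n w - it n z) <= del) ->
  ((mu + 1) / 2) ^+ N * nrm (w - z) <= S * nrm (it N w - it N z).
Proof.
move=> Jz h.
suff: ((mu + 1) / 2) ^+ N * (sig z * nrm (w - z)) <= sig (it N z) * nrm (it N w - it N z).
  have m0 : 0 <= ((mu + 1) / 2) ^+ N by rewrite exprn_ge0//; move: mu1; lra.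
  have h1 : ((mu + 1) / 2) ^+ N * nrm (w - z) <= ((mu + 1) / 2) ^+ N * (sig z * nrm (w - z)).
    by rewrite ler_wpM2l// nrm_le_sig.
  have h2 : sig (it N z) * nrm (it N w - it N z) <= S * nrm (it N w - it N z).
    exact: sig_le_nrm (Julia_iter d_ge2 p_deg p_monic N Jz).
  by move=> h3; apply: le_trans (le_trans h3 h2).
elim: N h => [|N IH] h; first by rewrite expr0 mul1r.
have JN := Julia_iter d_ge2 p_deg p_monic N Jz.
have h1 := expand_local JN (h N (ltnSn _)).
have {h1} := h1 (it N z); rewrite subrr nrm0 => /(_ (ltW del0)); apply: le_trans.
rewrite exprS -mulrA ler_wpM2l//; first by move: mu1; lra.
by apply: IH => n nN; apply: h; apply: ltnW.
Qed.

(** The finite shadowing points form a geometric Cauchy sequence, because [p]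
    expands the distance between two orbits that shadow the same points. *)
Lemma shadowing t (x : nat -> C) : (mu + 1) / 2 * t <= del ^+ d -> 2 * t <= del ->
  (forall n, near t (x n)) ->
  (forall n, S * nrm (p.[x n] - x n.+1) <= (mu - 1) / 2 * t) ->
  exists2 z, J z & forall n, nrm (x n - it n z) <= del.
Proof.
move=> ht t2 hx hp.
(* u N shadows the first N + 1 points *)
have /choice[u hu] : forall N, exists z, J z /\
    forall n, (n <= N)%N -> nrm (x n - it n z) <= t.
  move=> N; have [z Jz hz] := shadowing_finite ht N hx hp.
  exists z; split=> // n nN; exact: le_trans (nrm_le_sig _ _) (hz n nN).
have close N n : (n <= N)%N -> nrm (it n (u N.+1) - it n (u N)) <= 2 * t.
  move=> nN; have h1 := (hu N).2 n nN; have h2 := (hu N.+1).2 n (leqW nN).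
  have := nrm_tri (x n) (it n (u N.+1)) (it n (u N)).
  by rewrite [nrm (_ - x n)]nrmBC; move: h1 h2; lra.
have t0 : 0 <= t.
  by have := (hu 0%N).2 0%N isT; apply: le_trans; exact: nrm_ge0.
pose k := ((mu + 1) / 2)^-1.
have m1 : 1 < (mu + 1) / 2 by move: mu1; lra.
have k0 : 0 < k by rewrite invr_gt0; move: m1; lra.
have k1 : k < 1 by rewrite invf_lt1//; move: m1; lra.
have [||N|l hl] := @nrm_geometric_cvg R u (S * (2 * t)) k.
- by rewrite !mulr_ge0//; move: S1; lra.
- by rewrite k0 k1.
- rewrite /k exprVn ler_pdivlMr ?exprn_gt0//; last by move: m1; lra.
  rewrite mulrC; apply: le_trans (expand_orbit (hu N).1 _) _.
    by move=> n nN; apply: le_trans t2; apply: close; apply: ltnW.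
  by rewrite ler_wpM2l ?close//; move: S1; lra.
set B := (S * (2 * t) / (1 - k)) in hl.
have small e : 0 < e -> exists N0, forall N, (N0 <= N)%N -> nrm (l - u N) < e.
  move=> e0.
  have [N0 hN0] : exists n, B < e * (k^-1) ^+ n.
    by apply: geometric_exceeds => //; rewrite invf_gt1.
  exists N0 => N N0N; apply: le_lt_trans (hl N) _.
  rewrite -ltr_pdivlMr ?exprn_gt0// -exprVn; apply: lt_le_trans hN0 _.
  by rewrite ler_pM2l// ler_weXn2l// ltW// invf_gt1.
exists l.
  apply: (Julia_closed (p := p)).
  move=> A /nbhs_nrm [e e0 he]; have [N hN] := small e e0.
  by exists (u N); split; [exact: (hu N).1|apply: he; exact: hN].
move=> n; apply/ler_addgt0Pr => e e0.
have [h h0 hh] := horner_iter_near p n l e0.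
have [N0 hN0] := small h h0.
have h1 := hh _ (hN0 (N0 + n)%N (leq_addr _ _)).
have h2 := (hu (N0 + n)%N).2 n (leq_addl _ _).
have := nrm_tri (it n (u (N0 + n)%N)) (x n) (it n l).
rewrite [nrm (it n (u _) - _)]nrmBC; move: h1 h2 t2 t0; lra.
Qed.

End Expansion.

(** * The Hénon map and its bounded orbits *)

Section HenonBasics.
Variables (R : realType) (p : {poly Cplx R}) (a : Cplx R).
Local Notation C := (Cplx R).
Local Notation H := (henon p a).

Lemma nbhs_nrm2 (v : C * C) (P : set (C * C)) :
  nbhs v P <-> exists2 e : R, 0 < e &
    forall w, nrm (v.1 - w.1) < e -> nrm (v.2 - w.2) < e -> P w.
Proof.
split=> [/nbhs_ballP [e e0 he]|[e e0 he]].
  have er : e = (complex.Re e)%:C by rewrite RRe_real// gtr0_real.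
  exists (complex.Re e); first by rewrite -ltcR -er.
  move=> w h1 h2; apply: he; split; rewrite -ball_normE /ball_ /= normE er ltcR//.
apply/nbhs_ballP; exists e%:C => /=; first by rewrite ltcR.
move=> w []; rewrite -!ball_normE /ball_ /= !normE !ltcR; exact: he.
Qed.

Lemma cvg_pair_nrm (T : Type) (F : set_system T) (FF : Filter F) (f g : T -> C) u v :
  f x @[x --> F] --> u -> g x @[x --> F] --> v ->
  (f x, g x) @[x --> F] --> ((u, v) : C * C).
Proof.
move=> /(cvg_nrm FF) hf /(cvg_nrm FF) hg P /nbhs_nrm2 [e e0 he].
apply: filterS2 (hf e e0) (hg e e0) => x h1 h2; exact: he.
Qed.

Lemma KplusP v : Kplus p a v <->
  exists B : R, forall n, nrm (iter n H v).1 <= B /\ nrm (iter n H v).2 <= B.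
Proof.
rewrite /Kplus /= bounded_orbitP; split=> -[B hB]; exists B => n.
  by have := hB n; rewrite pair_norm_le => /andP.
by rewrite pair_norm_le; apply/andP.
Qed.

Lemma Kplus_henon v : Kplus p a (H v) <-> Kplus p a v.
Proof.
rewrite !KplusP; split=> -[B hB].
  exists (Num.max B (Num.max (nrm v.1) (nrm v.2))) => -[|n].
    by rewrite !le_max !lexx !orbT.
  by have [h1 h2] := hB n; rewrite iterSr !le_max h1 h2.
by exists B => n; rewrite -iterSr.
Qed.

Lemma henon_cvg (T : Type) (F : set_system T) (FF : Filter F) (f : T -> C * C) v :
  f x @[x --> F] --> v -> H (f x) @[x --> F] --> H v.
Proof.
move=> hf.
have h1 : (f x).1 @[x --> F] --> v.1 by apply: cvg_comp hf cvg_fst.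
have h2 : (f x).2 @[x --> F] --> v.2 by apply: cvg_comp hf cvg_snd.
have g1 : p.[(f x).1] + a * (f x).2 @[x --> F] --> p.[v.1] + a * v.2.
  exact: (cvgD (horner_cvg FF h1) (cvgMr h2)).
have g2 : a * (f x).1 @[x --> F] --> a * v.1.
  exact: (cvgMr h1).
exact: (cvg_pair_nrm FF g1 g2).
Qed.


Lemma henon_inv_cvg (T : Type) (F : set_system T) (FF : Filter F) (f : T -> C * C) v :
  f x @[x --> F] --> v -> henon_inv p a (f x) @[x --> F] --> henon_inv p a v.
Proof.
move=> hf.
have h1 : (f x).1 @[x --> F] --> v.1 by apply: cvg_comp hf cvg_fst.
have h2' : (f x).2 @[x --> F] --> v.2 by apply: cvg_comp hf cvg_snd.
have h2 : (f x).2 / a @[x --> F] --> v.2 / a.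
  exact: (cvgMl h2').
have g : ((f x).1 - p.[(f x).2 / a]) / a @[x --> F] --> (v.1 - p.[v.2 / a]) / a.
  exact: (cvgMl (cvgB h1 (horner_cvg FF h2))).
exact: (cvg_pair_nrm FF h2 g).
Qed.

Hypothesis a0 : a != 0.

(** The Hénon map is a homeomorphism that preserves [K+] in both directions. *)
Lemma Jplus_henon v : Jplus p a (H v) <-> Jplus p a v.
Proof.
have fwd w : Kplus p a w -> Kplus p a (H w) by rewrite Kplus_henon.
have bwd w : Kplus p a w -> Kplus p a (henon_inv p a w).
  by rewrite -{1}(henon_invK p a0 w) Kplus_henon.
have ch u : H w @[w --> u] --> H u by exact: (@henon_cvg _ (nbhs u) (nbhs_filter u) id).
have ci u : henon_inv p a w @[w --> u] --> henon_inv p a u.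
  by exact: (@henon_inv_cvg _ (nbhs u) (nbhs_filter u) id).
split=> -[cl nint]; split.
- move=> B hB; have [w [Kw Bw]] := cl (fun w => B (henon_inv p a w)) 
    (ci _ B (eq_ind_r (fun u => nbhs u B) hB (henonK p a0 v))).
  by exists (henon_inv p a w); split; [exact: bwd|].
- move=> hi; apply: nint.
  have h := ci (H v) _ (eq_ind_r (fun u => nbhs u _) hi (henonK p a0 v)).
  apply: (@filterS _ (nbhs (H v)) _ _ _ _ h) => w /fwd.
  by rewrite henon_invK.
- move=> B hB; have [w [Kw Bw]] := cl _ (ch _ B hB).
  by exists (H w); split; [exact: fwd|].
- move=> hi; apply: nint.
  have h := ch v _ hi.
  apply: (@filterS _ (nbhs v) _ _ _ _ h) => w.
  by rewrite /= Kplus_henon.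
Qed.

Lemma Jplus_iter n v : Jplus p a (iter n H v) <-> Jplus p a v.
Proof.
elim: n => [|n IH]; first exact: iff_refl.
rewrite iterS; exact: (iff_trans (Jplus_henon _) IH).
Qed.

Lemma henon_inv_iterK n v : iter n (henon_inv p a) (iter n H v) = v.
Proof. by elim: n v => // n IH v; rewrite iterSr iterS henonK. Qed.

Lemma henon_iterK n v : iter n H (iter n (henon_inv p a) v) = v.
Proof. by elim: n v => // n IH v; rewrite iterSr iterS henon_invK. Qed.

(** On the horizontal line at height [y] the iterates of the Hénon map are given
    by polynomials in the first coordinate. *)
Fixpoint henon_poly (y : C) (n : nat) : {poly C} * {poly C} :=
  if n is m.+1 then
    (p \Po (henon_poly y m).1 + a *: (henon_poly y m).2, a *: (henon_poly y m).1)
  else ('X, y%:P).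

Lemma henon_polyE x y n :
  iter n H (x, y) = ((henon_poly y n).1.[x], (henon_poly y n).2.[x]).
Proof.
elim: n => [|n IH]; first by rewrite /= hornerX hornerC.
by rewrite iterS IH /henon /= hornerD !hornerZ horner_comp.
Qed.
End HenonBasics.

Section EscapeRadius.
Variables (R : realType) (p : {poly Cplx R}) (a : Cplx R) (r : R).
Local Notation C := (Cplx R).
Local Notation H := (henon p a).
Hypothesis r0 : 0 < r.
Hypothesis a12 : nrm a <= 2^-1.
Hypothesis escape :
  ~` Kplus p a = \bigcup_k (iter k (henon p a) @^-1` escape_region r).

Lemma escape_regionE v : escape_region r v <-> Num.max (nrm v.2) r <= nrm v.1.
Proof.
rewrite /escape_region /= !normE.
have -> : Num.max (nrm v.2)%:C r%:C = (Num.max (nrm v.2) r)%:C.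
  by rewrite /Order.max ltcR; case: (_ < _).
by rewrite lecR.
Qed.

Lemma Kplus_lt v n : Kplus p a v ->
  nrm (iter n H v).1 < Num.max (nrm (iter n H v).2) r.
Proof.
move=> Kv; rewrite ltNge; apply/negP => h.
have : (~` Kplus p a) v by rewrite escape; exists n => //; apply/escape_regionE.
exact.
Qed.

Lemma Kplus_bidisk v : Kplus p a v -> nrm v.2 <= r -> forall n,
  nrm (iter n H v).1 <= r /\ nrm (iter n H v).2 <= r.
Proof.
move=> Kv hv.
have hx n : nrm (iter n H v).2 <= r -> nrm (iter n H v).1 <= r.
  move=> hy; have := Kplus_lt n Kv; rewrite max_r//; exact: ltW.
have hy n : nrm (iter n H v).2 <= r.
  elim: n => [//|n IH]; rewrite iterS /= nrmM.
  have := hx _ IH; have := nrm_ge0 (iter n H v).1; move: a12 r0 (nrm_ge0 a); nra.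
by move=> n; split; rewrite ?hx.
Qed.

Lemma Jplus_le v n : Jplus p a v ->
  nrm (iter n H v).1 <= Num.max (nrm (iter n H v).2) r.
Proof.
move=> [cl _].
have cit : iter n H w @[w --> v] --> iter n H v.
  elim: n => [|n IH]; first exact: (fun P hP => hP).
  exact: henon_cvg IH.
apply/ler_addgt0Pr => e e0.
pose B (u : C * C) := nrm ((iter n H v).1 - u.1) < e / 2 /\
  nrm ((iter n H v).2 - u.2) < e / 2.
have hB : nbhs (iter n H v) B.
  by apply/nbhs_nrm2; exists (e / 2); [rewrite divr_gt0|].
have [w [Kw [hw1 hw2]]] := cl _ (cit B hB).
have := Kplus_lt n Kw; have := nrm_lb (iter n H v).1 (iter n H w).1.
have := nrm_lb (iter n H w).2 (iter n H v).2; rewrite [nrm (_.2 - _.2)]nrmBC.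
have m1 : nrm (iter n H v).2 <= Num.max (nrm (iter n H v).2) r by rewrite le_max lexx.
have m2 : r <= Num.max (nrm (iter n H v).2) r by rewrite le_max lexx orbT.
rewrite lt_max => h1 h2 /orP[]; move: hw1 hw2 h1 h2 m1 m2; lra.
Qed.

(** While [|y| > r], each step at least halves [|y|]. *)
Lemma Jplus_attracted v : Jplus p a v -> exists n0, forall n, (n0 <= n)%N ->
  nrm (iter n H v).1 <= r /\ nrm (iter n.+1 H v).2 <= nrm a * r.
Proof.
move=> Jv; have hx n := Jplus_le n Jv.
have [k hk] : exists k, nrm (iter k H v).2 <= r.
  apply: contrapT => hn.
  have big n : r < nrm (iter n H v).2.
    by rewrite ltNge; apply/negP => h; apply: hn; exists n.
  have dec n : nrm (iter n H v).2 * 2 ^+ n <= nrm v.2.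
    elim: n => [|n IH]; first by rewrite expr0 mulr1.
    apply: le_trans IH; rewrite exprS mulrA ler_wpM2r ?exprn_ge0//.
    rewrite iterS /= nrmM; have := hx n; rewrite max_l ?(ltW (big n))//.
    have := nrm_ge0 (iter n H v).1; move: a12 (nrm_ge0 a); nra.
  have [n hn2] := geometric_exceeds r0 (ltr1n R 2) (nrm v.2).
  have := dec n; rewrite leNgt => /negP; apply; apply: lt_trans hn2 _.
  by rewrite ltr_pM2r ?exprn_gt0.
have hy n : nrm (iter (n + k)%N H v).2 <= r.
  elim: n => [//|n IH]; rewrite addSn iterS /= nrmM.
  have := hx (n + k)%N; rewrite max_r// => h; have := nrm_ge0 (iter (n + k)%N H v).1.
  move: h a12 r0 (nrm_ge0 a); nra.
exists k => n /subnK <-; have := hx (n - k + k)%N; rewrite max_r// => h.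
by split=> //; rewrite iterS /= nrmM ler_wpM2l ?nrm_ge0.
Qed.

End EscapeRadius.

#[local] Opaque Kplus Jplus.

(** * Hénon orbits shadowing the Julia set *)

Section HenonNearJulia.
Variables (R : realType) (d : nat) (p : {poly Cplx R}).
Hypotheses (d_ge2 : (2 <= d)%N) (p_deg : size p = d.+1) (p_monic : p \is monic).
Variables (sig : Cplx R -> R) (mu S del : R).
Hypothesis em : expanding_metric p sig mu S del.
Local Notation C := (Cplx R).
Local Notation J := (Julia p).
Local Notation K := (filled_Julia p).
Local Notation near := (Julia_near p sig).
Local Notation it n z := (iter n (horner p) z).
Implicit Types (z w x y : C).

Let mu1 : 1 < mu. Proof. exact: em_mu em. Qed.
Let S1 : 1 <= S. Proof. exact: em_S em. Qed.

Section OneParameter.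
Variable a : C.
Hypothesis a1 : nrm a <= 1.
Hypothesis aS : S * nrm a <= (mu - 1) / 4.
Local Notation H := (henon p a).

(** Here [dn] is a horizontal and [en] a vertical difference: as long as the
    horizontal one dominates, it is expanded. This is the cone condition for
    small [|a|]. *)
Lemma growth_step (dn dn1 en : R) : 0 <= dn ->
  (mu + 1) / 2 * dn - S * nrm a * en <= dn1 -> en <= dn ->
  (mu + 3) / 4 * dn <= dn1.
Proof.
move=> h0 h1 h2.
have h3 : S * nrm a * en <= (mu - 1) / 4 * dn.
  apply: (@le_trans _ _ (S * nrm a * dn)); last by rewrite ler_wpM2r.
  by rewrite ler_wpM2l// mulr_ge0 ?nrm_ge0//; move: S1; lra.
move: h1 h3; lra.
Qed.

(** The difference of the two orbits starts horizontal and stays so, hence grows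
    exponentially unless it vanishes; but both orbits stay close to that of [z]. *)
Lemma shadow_unique v v' z : J z -> v.2 = v'.2 ->
  (forall n, nrm ((iter n H v).1 - it n z) <= del) ->
  (forall n, nrm ((iter n H v').1 - it n z) <= del) -> v = v'.
Proof.
move=> Jz v2 hv hv'.
pose D n := sig (it n z) * nrm ((iter n H v).1 - (iter n H v').1).
pose E n := nrm ((iter n H v).2 - (iter n H v').2).
have D0 n : 0 <= D n by rewrite mulr_ge0 ?nrm_ge0 ?ltW ?(sig_gt0 em).
have step n : E n <= D n -> (mu + 3) / 4 * D n <= D n.+1.
  move=> hE; apply: (growth_step (D0 n)) hE.
  have Jn := Julia_iter d_ge2 p_deg p_monic n Jz.
  have h1 := expand_local em Jn (hv n) (hv' n).
  have J1 := Julia_iter d_ge2 p_deg p_monic n.+1 Jz.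
  rewrite /D /E !iterS /=.
  set x := (iter n H v).1 in h1 *; set x' := (iter n H v').1 in h1 *.
  set y := (iter n H v).2; set y' := (iter n H v').2; set zz := it n z in h1 J1 *.
  have h2 : sig p.[zz] * nrm (p.[x] - p.[x']) <=
     sig p.[zz] * (nrm (p.[x] + a * y - (p.[x'] + a * y')) + nrm a * nrm (y - y')).
    rewrite ler_pM2l ?(sig_gt0 em)// -nrmM.
    have -> : p.[x] - p.[x'] = (p.[x] + a * y - (p.[x'] + a * y')) - a * (y - y') by ring.
    exact: nrmB.
  have h3 : sig p.[zz] * (nrm a * nrm (y - y')) <= S * (nrm a * nrm (y - y')).
    by rewrite ler_wpM2r ?mulr_ge0 ?nrm_ge0// (em_leS em).
  move: h1 h2 h3; rewrite mulrDr; lra.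
have inv n : E n <= D n.
  elim: n => [|n IH].
    by rewrite /E /= v2 subrr nrm0.
  have h1 := step n IH.
  have h2 : E n.+1 <= D n.
    rewrite /E !iterS /= -mulrBr nrmM.
    apply: (@le_trans _ _ (nrm ((iter n H v).1 - (iter n H v').1))).
      by rewrite ler_piMl ?nrm_ge0.
    exact: (nrm_le_sig em).
  have h3 : D n <= (mu + 3) / 4 * D n by rewrite ler_peMl//; move: mu1; lra.
  exact: le_trans h2 (le_trans h3 h1).
have grow n : ((mu + 3) / 4) ^+ n * D 0%N <= D n.
  elim: n => [|n IH]; first by rewrite expr0 mul1r.
  apply: le_trans (step n (inv n)).
  by rewrite exprS -mulrA ler_wpM2l//; move: mu1; lra.
have Dle n : D n <= S * (2 * del).
  apply: le_trans (sig_le_nrm em _ (Julia_iter d_ge2 p_deg p_monic n Jz)) _.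
  rewrite ler_wpM2l//; first by move: S1; lra.
  have := nrm_tri (it n z) (iter n H v).1 (iter n H v').1.
  rewrite [nrm (it n z - _)]nrmBC; move: (hv n) (hv' n); lra.
have D00 : D 0%N = 0.
  apply/eqP; rewrite eq_le D0 andbT leNgt; apply/negP => Dpos.
  have [|n hn] := @geometric_exceeds R _ ((mu + 3) / 4) Dpos _ (S * (2 * del)).
    by move: mu1; lra.
  have := le_trans (grow n) (Dle n); rewrite mulrC => /(lt_le_trans hn).
  by rewrite ltxx.
move/eqP: D00; rewrite /D mulf_eq0 (gt_eqF (sig_gt0 em _)) /= nrm_eq0 subr_eq0 => /eqP.
by case: v v' v2 {hv hv' D E D0 step inv grow Dle} => ? ? [? ?] /= -> ->.
Qed.

(** Same cone argument as in [shadow_unique], for a horizontal tangent vector. *)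
Lemma shadow_deriv_growth x y z : J z ->
  (forall n, nrm ((iter n H (x, y)).1 - it n z) <= del) ->
  forall n, ((mu + 3) / 4) ^+ n <= S * nrm ((henon_poly p a y n).1^`().[x]).
Proof.
move=> Jz hx.
pose f n := (henon_poly p a y n).1; pose g n := (henon_poly p a y n).2.
have fE n : (f n).[x] = (iter n H (x, y)).1 by rewrite henon_polyE.
pose D n := sig (it n z) * nrm ((f n)^`().[x]).
pose E n := nrm ((g n)^`().[x]).
have D0 n : 0 <= D n by rewrite mulr_ge0 ?nrm_ge0 ?ltW ?(sig_gt0 em).
have step n : E n <= D n -> (mu + 3) / 4 * D n <= D n.+1.
  move=> hE; apply: (growth_step (D0 n)) hE.
  have Jn := Julia_iter d_ge2 p_deg p_monic n Jz.
  have h1 := em_deriv em Jn (hx n); rewrite -fE in h1.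
  have J1 := Julia_iter d_ge2 p_deg p_monic n.+1 Jz.
  have fS : (f n.+1)^`().[x] = p^`().[(f n).[x]] * (f n)^`().[x] + a * (g n)^`().[x].
    by rewrite /f /g /= derivD derivZ deriv_comp hornerD hornerZ hornerM horner_comp.
  rewrite /D /E iterS fS.
  rewrite iterS in J1.
  set u := (f n)^`().[x]; set v := (g n)^`().[x]; set q := p^`().[_] in h1 *.
  have h2 : sig p.[it n z] * (nrm q * nrm u) <=
      sig p.[it n z] * (nrm (q * u + a * v) + nrm a * nrm v).
    rewrite ler_pM2l ?(sig_gt0 em)// -!nrmM.
    by rewrite -[X in nrm X <= _](addrK (a * v)) nrmB.
  have h3 : sig p.[it n z] * (nrm a * nrm v) <= S * (nrm a * nrm v).
    by rewrite ler_wpM2r ?mulr_ge0 ?nrm_ge0// (em_leS em).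
  have h4 : (mu + 1) / 2 * sig (it n z) * nrm u <= sig p.[it n z] * nrm q * nrm u.
    by rewrite ler_wpM2r ?nrm_ge0.
  move: h2 h3 h4; rewrite mulrDr; lra.
have inv n : E n <= D n.
  elim: n => [|n IH].
    by rewrite /E /g /= derivC horner0 nrm0.
  have h1 := step n IH.
  have h2 : E n.+1 <= D n.
    rewrite /E /g /= derivZ hornerZ nrmM.
    apply: (@le_trans _ _ (nrm (f n)^`().[x])).
      by rewrite ler_piMl ?nrm_ge0.
    exact: (nrm_le_sig em).
  have h3 : D n <= (mu + 3) / 4 * D n by rewrite ler_peMl//; move: mu1; lra.
  exact: le_trans h2 (le_trans h3 h1).
move=> n.
apply: le_trans (sig_le_nrm em _ (Julia_iter d_ge2 p_deg p_monic n Jz)).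
rewrite -/(f n) -/(D n); elim: n => [|n IH].
  by rewrite expr0 /D /f /= derivX hornerC nrm1 mulr1 (em_ge1 em).
apply: le_trans (step n (inv n)).
by rewrite exprS ler_wpM2l//; move: mu1; lra.
Qed.

(** Were a horizontal disk around [v] contained in [K+], the first coordinates of
    the iterates would be bounded by [r] on it, and Cauchy's estimate would bound
    their derivatives. *)
Lemma shadow_not_interior r v z :
  (forall u, Kplus p a u -> nrm u.2 <= r -> forall n, nrm (iter n H u).1 <= r) ->
  J z -> nrm v.2 <= r ->
  (forall n, nrm ((iter n H v).1 - it n z) <= del) -> ~ (Kplus p a)° v.
Proof.
case: v => x y hK Jz /= hy hx /nbhs_nrm2 [e e0 he].
pose rho := e / 2.
have rho0 : 0 < rho by rewrite divr_gt0.
have bnd n : rho * nrm ((henon_poly p a y n).1^`().[x]) <= r.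
  apply: cauchy_estimate => // u hu.
  have -> : (henon_poly p a y n).1.[u] = (iter n H (u, y)).1 by rewrite henon_polyE.
  apply: hK => //; apply: he => /=; last by rewrite subrr nrm0.
  by rewrite nrmBC; apply: le_lt_trans hu _; rewrite /rho; lra.
have [|n hn] := @geometric_exceeds R _ ((mu + 3) / 4) rho0 _ (S * r).
  by move: mu1; lra.
have := shadow_deriv_growth Jz hx n; rewrite -(ler_pM2l rho0) => h.
have := lt_le_trans hn h; rewrite mulrCA ltr_pM2l; last by move: S1; lra.
by rewrite ltNge bnd.
Qed.

End OneParameter.
End HenonNearJulia.

(** * Orbits in the boundary of K+ end up near the Julia set *)

Section Perturb.
Variables (R : realType) (p : {poly Cplx R}).
Local Notation C := (Cplx R).
Local Notation it n z := (iter n (horner p) z).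

Lemma pseudo_orbit_close (B : R) N : 0 <= B -> forall e : R, 0 < e ->
  exists2 eta : R, 0 < eta & forall x : nat -> C,
    (forall n, nrm (x n) <= B) -> (forall n, nrm (p.[x n] - x n.+1) <= eta) ->
    nrm (it N (x 0%N) - x N) <= e.
Proof.
move=> B0; elim: N => [|N IH] e e0.
  by exists 1 => // x _ _; rewrite subrr nrm0 ltW.
have [|L L0 hL] := @poly_lip R p (B + 1); first by lra.
pose e' := Num.min 1 (e / 2 / (L + 1)).
have L10 : 0 < L + 1 by lra.
have e'0 : 0 < e' by rewrite lt_min ltr01 !divr_gt0.
have [eta eta0 heta] := IH e' e'0.
exists (Num.min eta (e / 2)); first by rewrite lt_min eta0 divr_gt0.
move=> x hB hx.
have h1 : nrm (it N (x 0%N) - x N) <= e'.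
  by apply: heta => // n; apply: le_trans (hx n) _; rewrite ge_min lexx.
have h2 : nrm (p.[x N] - x N.+1) <= e / 2.
  by apply: le_trans (hx N) _; rewrite ge_min lexx orbT.
have h3 : nrm (p.[it N (x 0%N)] - p.[x N]) <= L * nrm (it N (x 0%N) - x N).
  apply: hL; last by have := hB N; lra.
  have := nrm_lb (it N (x 0%N)) (x N); have := hB N.
  have : e' <= 1 by rewrite ge_min lexx.
  move: h1; lra.
have h4 : L * e' <= e / 2.
  have : (L + 1) * e' <= e / 2.
    by rewrite mulrC -ler_pdivlMr// ge_min lexx orbT.
  by rewrite mulrDl; move: e'0; lra.
have h5 : L * nrm (it N (x 0%N) - x N) <= L * e' by rewrite ler_wpM2l.
rewrite iterS; have := nrm_tri p.[x N] p.[it N (x 0%N)] (x N.+1).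
move: h2 h3 h4 h5; lra.
Qed.

End Perturb.

Section Trapping.
Variables (R : realType) (d : nat) (p : {poly Cplx R}).
Hypotheses (d_ge2 : (2 <= d)%N) (p_deg : size p = d.+1) (p_monic : p \is monic).
Variables (sig : Cplx R -> R) (mu S del : R).
Hypothesis em : expanding_metric p sig mu S del.
Local Notation C := (Cplx R).
Local Notation J := (Julia p).
Local Notation K := (filled_Julia p).
Local Notation near := (Julia_near p sig).
Local Notation it n z := (iter n (horner p) z).
Implicit Types (z w x y : C).

Let mu1 : 1 < mu. Proof. exact: em_mu em. Qed.
Let S1 : 1 <= S. Proof. exact: em_S em. Qed.

(** A segment from [K] to its complement crosses [J]. *)
Lemma near_segment t x y : 0 <= t -> S * nrm (x - y) <= t -> ~ near t x ->
  K x <-> K y.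
Proof.
move=> t0 hxy nx.
have key u v : nrm (u - x) <= nrm (x - y) -> nrm (v - x) <= nrm (x - y) -> K u -> ~ K v -> False.
  move=> hu hv Ku nKv; have [s /andP[s0 s1] Jz] := segment_frontier Ku nKv.
  set z := u + _ in Jz; apply: nx; exists z; first exact: Jz.
  apply: le_trans (sig_le_nrm em _ Jz) _; apply: le_trans hxy.
  rewrite ler_wpM2l//; first by move: S1; lra.
  have -> : x - z = (1 - s)%:C * (x - u) + s%:C * (x - v).
    by rewrite /z rmorphB rmorph1; ring.
  apply: le_trans (nrmD _ _) _; rewrite !nrmM !nrm_real !ger0_norm//; last lra.
  rewrite [nrm (x - u)]nrmBC [nrm (x - v)]nrmBC.
  have : (1 - s) * nrm (u - x) <= (1 - s) * nrm (x - y) by rewrite ler_wpM2l//; lra.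
  have : s * nrm (v - x) <= s * nrm (x - y) by rewrite ler_wpM2l.
  lra.
have h1 : nrm (x - x) <= nrm (x - y) by rewrite subrr nrm0 nrm_ge0.
have h2 : nrm (y - x) <= nrm (x - y) by rewrite nrmBC.
by split=> h; apply: contrapT => nh; [exact: (key x y)|exact: (key y x)].
Qed.

(** Away from [J] a step of [p] increases the distance to [J] by a factor, and the
    margin absorbs the perturbation: the perturbed point is again away from [J],
    and too close to [p x] to be separated from it by [J]. *)
Lemma far_step t x x' : 0 <= t -> (mu + 1) / 2 * t <= del ^+ d -> ~ near t x ->
  S * nrm (p.[x] - x') <= (mu - 1) / 2 * t -> ~ near t x' /\ (K x' <-> K x).
Proof.
move=> t0 ht nx hx.
have npx : ~ near ((mu + 1) / 2 * t) p.[x].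
  by move=> h; apply: nx; apply: (near_pull d_ge2 p_deg p_monic em ht h).
split.
  move=> /(near_shift em p.[x]) h; apply: npx; apply: near_le h.
  by rewrite [nrm (x' - _)]nrmBC; move: hx; lra.
rewrite -(filled_Julia_horner p x); apply: iff_sym.
apply: (near_segment _ _ npx); first by rewrite mulr_ge0//; move: mu1; lra.
by move: hx t0; lra.
Qed.

(** Compactness: the points of a closed disk that are outside [K] and away from [J]
    form a closed set, as a limit of them in [K] would belong to [J]. *)
Lemma far_escape_time (R0 t : R) : 0 < t -> 1 <= R0 ->
  (forall z, R0 <= nrm z -> 2 * nrm z <= nrm p.[z]) ->
  exists N, forall z, nrm z <= R0 -> ~ K z -> ~ near t z -> R0 < nrm (it N z).
Proof.
move=> t0 R1 hR.
pose A : set C := [set z | [/\ nrm z <= R0, ~ K z &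
  forall w, J w -> t <= sig w * nrm (z - w)]].
have cA : closed A.
  apply/closed_nrm => z hz.
  have far w : J w -> t <= sig w * nrm (z - w).
    move=> Jw; apply/ler_addgt0Pr => e e0.
    have sw := sig_gt0 em w.
    have [u [_ _ hu] zu] := hz (e / sig w) (divr_gt0 e0 sw).
    apply: le_trans (hu w Jw) _.
    have h1 : sig w * nrm (u - w) <= sig w * (nrm (u - z) + nrm (z - w)).
      by rewrite ler_pM2l// nrm_tri.
    have h2 : sig w * nrm (u - z) <= e.
      by rewrite mulrC -ler_pdivlMr// nrmBC ltW.
    move: h1 h2; rewrite mulrDr; lra.
  split=> //.
    apply/ler_addgt0Pr => e e0; have [u [hu _ _] zu] := hz e e0.
    by have := nrm_lb z u; lra.
  move=> Kz; have Jz : J z.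
    apply/frontierP => e e0; split; first by exists z => //; rewrite subrr nrm0.
    by have [u [_ Ku _] zu] := hz e e0; exists u.
  have := far z Jz; rewrite subrr nrm0 mulr0; lra.
have bA z : A z -> nrm z <= R0 by case.
pose P n : set C := [set z | R0 < nrm (it n z)].
have [||||N hN] := @compact_uniform_index R A P.
- exact: compact_nrm cA bA.
- move=> n; rewrite openE => z hz; apply/nbhs_nrm.
  have e0 : 0 < nrm (it n z) - R0 by rewrite subr_gt0.
  have [h h0 hh] := horner_iter_near p n z e0.
  exists h => // w /hh; rewrite /P /=; have := nrm_lb (it n z) (it n w); lra.
- move=> m n z mn hm; rewrite /P /= -(subnK mn) iterD.
  exact: escape_iter.
- move=> z [_ nK _]; apply: contrapT => hn; apply: nK.
  rewrite (filled_Julia_escape R1 hR) => n; rewrite leNgt; apply/negP => h.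
  by apply: hn; exists n.
exists N => z zR nK nz; apply: hN; split=> // w Jw; rewrite leNgt; apply/negP => h.
by apply: nz; exists w => //; apply: ltW.
Qed.

Lemma henon_far_step a t v : 0 <= t -> (mu + 1) / 2 * t <= del ^+ d ->
  S * (nrm a * nrm v.2) <= (mu - 1) / 2 * t -> ~ near t v.1 ->
  ~ near t (henon p a v).1 /\ (K (henon p a v).1 <-> K v.1).
Proof.
move=> t0 ht hv nv; apply: (far_step t0 ht nv).
by rewrite /= opprD addrA subrr add0r nrmN nrmM.
Qed.

(** The orbits of all points in a neighbourhood stay in [K] and away from [J] at the
    scale [t / 2], hence are bounded. *)
Lemma trapped_interior a (R0 t : R) v : 1 <= R0 ->
  (forall z, R0 <= nrm z -> 2 * nrm z <= nrm p.[z]) ->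
  0 < t -> (mu + 1) / 2 * t <= del ^+ d -> nrm a * R0 <= 1 ->
  S * nrm a <= (mu - 1) * t / 16 ->
  K v.1 -> ~ near t v.1 -> nrm v.2 <= 1 -> (Kplus p a)° v.
Proof.
move=> R1 hR t0 ht haR hab Kv nv hv; apply/nbhs_nrm2.
have t20 : 0 < t / 2 by rewrite divr_gt0.
have m0 : 0 <= (mu + 1) / 2 by move: mu1; lra.
have S0 : 0 < S by exact: lt_le_trans ltr01 S1.
have ht2 : (mu + 1) / 2 * (t / 2) <= del ^+ d.
  apply: le_trans ht; rewrite ler_wpM2l//.
  by move: t0; lra.
pose e := Num.min 1 (t / 2 / S).
have e0 : 0 < e by rewrite lt_min ltr01 !divr_gt0.
exists e => // u hu1 hu2.
have hSe : S * nrm (v.1 - u.1) <= t / 2.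
  rewrite mulrC -ler_pdivlMr//.
  by apply: le_trans (ltW hu1) _; rewrite ge_min lexx orbT.
have un : ~ near (t / 2) u.1.
  move=> /(near_shift em v.1) h; apply: nv; apply: near_le h.
  by rewrite [nrm (u.1 - _)]nrmBC; move: hSe; lra.
have uK : K u.1.
  have hSt : S * nrm (v.1 - u.1) <= t by move: hSe t0; lra.
  exact: (near_segment (ltW t0) hSt nv).1 Kv.
have uy : nrm u.2 <= 2.
  have h := nrm_lb u.2 v.2; rewrite nrmBC in h.
  have e1 : e <= 1 by rewrite ge_min lexx.
  by move: h e1 hv hu2; lra.
have hstep (y : C) : nrm y <= 2 -> S * (nrm a * nrm y) <= (mu - 1) / 2 * (t / 2).
  move=> hy; have h1 : S * (nrm a * nrm y) <= S * (nrm a * 2).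
    by rewrite ler_pM2l// ler_wpM2l ?nrm_ge0.
  have mt : 0 <= (mu - 1) * t by apply: mulr_ge0; [move: mu1; lra|exact: ltW].
  by move: h1 mt hab; lra.
have inv m : [/\ ~ near (t / 2) (iter m (henon p a) u).1,
    K (iter m (henon p a) u).1 & nrm (iter m (henon p a) u).2 <= 2].
  elim: m => [//|m [nm Km ym]]; rewrite iterS.
  have [nm1 KK] := henon_far_step (ltW t20) ht2 (hstep _ ym) nm.
  split; [exact: nm1|exact/KK|rewrite /= nrmM].
  have xR := (filled_Julia_escape R1 hR _).1 Km 0%N; rewrite /= in xR.
  have h : nrm a * nrm (iter m (henon p a) u).1 <= nrm a * R0.
    by rewrite ler_wpM2l ?nrm_ge0.
  by move: h haR; lra.
apply/KplusP; exists (R0 + 2) => m; have [_ Km ym] := inv m.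
have xR := (filled_Julia_escape R1 hR _).1 Km 0%N; rewrite /= in xR.
by move: xR ym R1; split; lra.
Qed.

(** By [henon_far_step] the first coordinates stay outside [K] and away from [J].
    For small [a] they follow the orbit of [v.1] under [p] up to the escape time of
    [far_escape_time]. *)
Lemma outside_unbounded (R0 t : R) : 1 <= R0 ->
  (forall z, R0 <= nrm z -> 2 * nrm z <= nrm p.[z]) ->
  0 < t -> (mu + 1) / 2 * t <= del ^+ d ->
  exists2 eta : R, 0 < eta & forall a v, nrm a < eta ->
    S * nrm a <= (mu - 1) * t / 16 -> ~ K v.1 -> ~ near t v.1 ->
    (forall n, nrm (iter n (henon p a) v).2 <= 1) ->
    ~ (forall n, nrm (iter n (henon p a) v).1 <= R0 - 1).
Proof.
move=> R1 hR t0 ht.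
have [N hN] := far_escape_time t0 R1 hR.
have R00 : 0 <= R0 by move: R1; lra.
have [eta eta0 heta] := @pseudo_orbit_close R p R0 N R00 _ ltr01.
exists eta => // a v aeta hab nK nv hy hx.
have far n : ~ near t (iter n (henon p a) v).1 /\ ~ K (iter n (henon p a) v).1.
  elim: n => [//|n [nn nKn]]; rewrite iterS.
  have hstep : S * (nrm a * nrm (iter n (henon p a) v).2) <= (mu - 1) / 2 * t.
    have h1 : S * (nrm a * nrm (iter n (henon p a) v).2) <= S * (nrm a * 1).
      by rewrite ler_wpM2l ?ler_wpM2l ?nrm_ge0// (le_trans ler01 S1).
    have mt : 0 <= (mu - 1) * t by apply: mulr_ge0; [move: mu1; lra|exact: ltW].
    by move: h1 mt hab; lra.
  have [nm1 KK] := henon_far_step (ltW t0) ht hstep nn.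
  by split=> // /KK.
have hfin : R0 < nrm (iter N (horner p) v.1).
  by apply: hN => //; have := hx 0%N; rewrite /=; lra.
have hclose := heta (fun n => (iter n (henon p a) v).1).
have h1 : nrm (iter N (horner p) v.1 - (iter N (henon p a) v).1) <= 1.
  apply: hclose => n; first by apply: le_trans (hx n) _; lra.
  rewrite iterS /= opprD addrA subrr add0r nrmN nrmM.
  apply: le_trans (ltW aeta).
  by rewrite ler_piMr ?nrm_ge0.
have := nrm_lb (iter N (horner p) v.1) (iter N (henon p a) v).1.
by have := hx N; move: hfin h1; lra.
Qed.

(** A point of the orbit away from [J] would be interior to [K+] if its first
    coordinate is in [K], and would escape otherwise. *)
Lemma Jplus_eventually_near (r t : R) : 0 < r -> 0 < t ->
  (mu + 1) / 2 * t <= del ^+ d ->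
  exists2 a0 : R, 0 < a0 & forall a, 0 < nrm a -> nrm a < a0 ->
    ~` Kplus p a = \bigcup_k (iter k (henon p a) @^-1` escape_region r) ->
    forall v, Jplus p a v -> exists n0, forall n, (n0 <= n)%N ->
      near t (iter n (henon p a) v).1 /\ nrm (iter n (henon p a) v).2 <= 1.
Proof.
move=> r0 t0 ht.
have [R0 [R1 rR hR]] := poly_escape (r + 1) d_ge2 p_deg p_monic.
have [eta eta0 heta] := outside_unbounded R1 hR t0 ht.
have R00 : 0 < R0 by move: R1; lra.
have S0 : 0 < S by exact: lt_le_trans ltr01 S1.
pose b := (mu - 1) * t / 16 / S.
have b0 : 0 < b by rewrite !divr_gt0 ?mulr_gt0//; move: mu1; lra.
exists (Num.min (Num.min (2^-1) eta) (Num.min (R0^-1) b)).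
  by rewrite !lt_min b0 invr_gt0 ltr0n eta0 invr_gt0 R00.
move=> a ap; rewrite !lt_min => /andP[/andP[a2 aeta] /andP[aR ab]] esc v Jv.
have an0 : a != 0 by rewrite -nrm_gt0.
have hab : S * nrm a <= (mu - 1) * t / 16 by rewrite mulrC -ler_pdivlMr ?ltW.
have haR : nrm a * R0 <= 1 by rewrite -ler_pdivlMr ?mul1r ?ltW.
have [n1 hn1] := Jplus_attracted r0 (ltW a2) esc Jv.
exists n1.+1 => n nn.
have hx m : nrm (iter m (henon p a) (iter n (henon p a) v)).1 <= R0 - 1.
  rewrite -iterD.
  have [h _] := hn1 (m + n)%N (leq_trans (ltnW nn) (leq_addl _ _)).
  by move: h rR; lra.
have hy m : nrm (iter m (henon p a) (iter n (henon p a) v)).2 <= 1.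
  rewrite -iterD -(prednK (leq_trans (ltn0Sn _) (leq_trans nn (leq_addl m n)))).
  have [|_ h] := hn1 (m + n).-1.
    by rewrite -ltnS prednK ?(leq_trans nn) ?leq_addl// (leq_trans _ (leq_addl m n)) ?(leq_trans _ nn).
  have h2 : nrm a * r <= nrm a * R0 by rewrite ler_wpM2l ?nrm_ge0//; move: rR; lra.
  exact: le_trans h (le_trans h2 haR).
split; last exact: (hy 0%N).
apply: contrapT => nnear.
have [Kx|nKx] := pselect (K (iter n (henon p a) v).1); last first.
  exact: (heta a _ aeta hab nKx nnear hy hx).
have [_ nint] : Jplus p a (iter n (henon p a) v) by apply/Jplus_iter.
exact: nint (trapped_interior R1 hR t0 ht haR hab Kx nnear (hy 0%N)).
Qed.

End Trapping.

(** * The semiconjugacy near the origin of the fibres *)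

Section Cutoff.
Variable R : realType.
Local Notation C := (Cplx R).

Definition cutoff (l t : R) : R := Num.min 1 (Num.max 0 (2 - t / l)).

Lemma cutoff_ge0 l t : 0 <= cutoff l t.
Proof. by rewrite le_min ler01 le_max lexx. Qed.

Lemma cutoff_le1 l t : cutoff l t <= 1.
Proof. by rewrite ge_min lexx. Qed.

Lemma cutoff1 l t : 0 < l -> t <= l -> cutoff l t = 1.
Proof.
move=> l0 tl; rewrite /cutoff min_l// le_max; apply/orP; right.
by have : t / l <= 1 by [rewrite ler_pdivrMr// mul1r]; lra.
Qed.

Lemma cutoff0 l t : 0 < l -> 2 * l <= t -> cutoff l t = 0.
Proof.
move=> l0 tl; rewrite /cutoff max_l ?min_r//.
by have : 2 <= t / l by [rewrite ler_pdivlMr]; lra.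
Qed.

Lemma cutoff_lip l s t : 0 < l -> `|cutoff l s - cutoff l t| <= `|s - t| / l.
Proof.
move=> l0.
suff key u v : u <= v -> `|cutoff l u - cutoff l v| <= (v - u) / l.
  have [st|/ltW ts] := leP s t.
    by rewrite [`|s - t|]distrC (ger0_norm (x := t - s)) ?subr_ge0// key.
  by rewrite distrC (ger0_norm (x := s - t)) ?subr_ge0// key.
move=> uv.
have h : u / l <= v / l by rewrite ler_pM2r ?invr_gt0.
rewrite mulrBl; set x := u / l in h *; set y := v / l in h *.
have c (w : R) : [\/ w <= 1 /\ Num.min 1 (Num.max 0 (2 - w)) = 1,
    1 <= w <= 2 /\ Num.min 1 (Num.max 0 (2 - w)) = 2 - w |
    2 <= w /\ Num.min 1 (Num.max 0 (2 - w)) = 0].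
  have [w1|w1] := leP w 1.
    by constructor 1; rewrite min_l// le_max; apply/orP; right; lra.
  have [w2|w2] := leP w 2.
    constructor 2; rewrite max_r; last lra.
    by rewrite min_r; [rewrite (ltW w1)|lra].
  by constructor 3; rewrite max_l ?min_r ?(ltW w2)//; lra.
rewrite /cutoff -/x -/y ler_norml.
by case: (c x) => -[? ->]; case: (c y) => -[? ->]; apply/andP; split; lra.
Qed.

Lemma cutoff_cvg l (T : Type) (F : set_system T) (FF : Filter F) (f : T -> C) z :
  0 < l -> f x @[x --> F] --> z ->
  ((cutoff l (nrm (f x)))%:C : C) @[x --> F] --> ((cutoff l (nrm z))%:C : C).
Proof.
move=> l0 /(cvg_nrm FF) hf; apply/(cvg_nrm FF) => e e0.
apply: filterS (hf (e * l) (mulr_gt0 e0 l0)) => x hx.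
rewrite -rmorphB /= nrm_real; apply: le_lt_trans (cutoff_lip _ _ l0) _.
rewrite ltr_pdivrMr//; apply: le_lt_trans hx.
have := nrm_lb z (f x); have := nrm_lb (f x) z; rewrite [nrm (f x - z)]nrmBC.
by move=> h1 h2; rewrite ler_norml; lra.
Qed.

(** Vanishes on the unit disk, where the second coordinate is prescribed by the
    functional equation, and is the affine map [w |-> 2 (w - 2)] on the disk of
    radius [1/2] centred at [2], which it sends onto the unit disk. *)
Definition filler (w : C) : C := (cutoff 2^-1 (nrm (w - 2)))%:C * (2 * (w - 2)).

Lemma filler_le2 w : nrm (filler w) <= 2.
Proof.
rewrite /filler !nrmM nrm_real ger0_norm ?cutoff_ge0// nrm_nat.
have t0 := nrm_ge0 (w - 2).
have [h|h] := leP 1 (nrm (w - 2)); first by rewrite cutoff0 ?mul0r; lra.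
have := cutoff_le1 2^-1 (nrm (w - 2)); have := cutoff_ge0 2^-1 (nrm (w - 2)).
nra.
Qed.

Lemma filler0 w : nrm w <= 1 -> filler w = 0.
Proof.
move=> hw; rewrite /filler cutoff0 ?mul0r//.
by have := nrm_lb 2 w; rewrite nrm_nat [nrm (2 - w)]nrmBC; lra.
Qed.

Lemma filler_onto y : nrm y <= 1 -> exists w, [/\ 1 <= nrm w, nrm w < 3 & filler w = y].
Proof.
move=> hy; exists (2 + y / 2).
have h2 : nrm (y / 2) <= 2^-1.
  by rewrite nrmM nrmV nrm_nat ler_pdivrMr// mulVf.
split.
- by have := nrm_lb 2 (- (y / 2)); rewrite opprK nrmN nrm_nat; lra.
- by have := nrmD 2 (y / 2); rewrite nrm_nat; lra.
- by rewrite /filler [2 + _]addrC addrK cutoff1 ?invr_gt0// mul1r mulrC divfK// pnatr_eq0.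
Qed.

Lemma filler_cvg (T : Type) (F : set_system T) (FF : Filter F) (f : T -> C) z :
  f x @[x --> F] --> z -> filler (f x) @[x --> F] --> filler z.
Proof.
move=> hf.
have h1 : f x - 2 @[x --> F] --> z - 2 by exact: (cvgB hf (cvg_cst _)).
have l0 : 0 < (2^-1 : R) by rewrite invr_gt0.
exact: (cvgM (cutoff_cvg FF l0 h1) (cvgMr h1)).
Qed.

End Cutoff.

Section Contraction.
Variables (R : realType) (d : nat) (p : {poly Cplx R}).
Hypotheses (d_ge2 : (2 <= d)%N) (p_deg : size p = d.+1) (p_monic : p \is monic).
Variables (sig : Cplx R -> R) (mu S del : R).
Hypothesis em : expanding_metric p sig mu S del.
Local Notation C := (Cplx R).
Local Notation J := (Julia p).
Implicit Types (z w x y : C) (v u : C * C).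

Let mu1 : 1 < mu. Proof. exact: em_mu em. Qed.
Let S1 : 1 <= S. Proof. exact: em_S em. Qed.
Let del0 : 0 < del. Proof. by have /andP[] := em_del em. Qed.
Let del1 : del <= 1. Proof. by have /andP[] := em_del em. Qed.

Lemma deriv_lb z : J z -> 1 <= S * nrm p^`().[z].
Proof.
move=> Jz; have h := em_expand em Jz.
have Jp := Julia_step d_ge2 p_deg p_monic Jz.
have h2 := sig_le_nrm em p^`().[z] Jp.
have h3 := em_ge1 em z; have h4 : sig z <= mu * sig z by rewrite ler_peMl//; move: mu1 h3; lra.
by move: h h2 h3 h4; lra.
Qed.

Lemma deriv_neq0 z : J z -> p^`().[z] != 0.
Proof.
move=> /deriv_lb h; apply/eqP => h0; move: h.
by rewrite h0 nrm0 mulr0; lra.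
Qed.

Lemma Julia_inj_local z z' : J z -> p.[z] = p.[z'] -> nrm (z' - z) <= del -> z = z'.
Proof.
move=> Jz pz hz.
have h0 : nrm (z - z) <= del by rewrite subrr nrm0 ltW.
have := expand_local em Jz h0 hz; rewrite pz subrr nrm0 mulr0.
have h1 := nrm_le_sig em z (z - z').
have : sig z * nrm (z - z') <= (mu + 1) / 2 * (sig z * nrm (z - z')).
  rewrite ler_peMl//; last by move: mu1; lra.
  by rewrite mulr_ge0 ?nrm_ge0 ?ltW ?(sig_gt0 em).
move=> h2 h3; apply/eqP; rewrite -subr_eq0 -nrm_le0; move: h1 h2 h3; lra.
Qed.

Variables (r eps : R).
Hypothesis r3 : 3 < r.
Hypothesis Jr : forall z, J z -> nrm z <= r.
Hypothesis eps0 : 0 < eps.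
Hypothesis eps_del : 6 * eps * r * S <= del.
Hypothesis eps_r : eps * (r + 1) <= 1.

Let rho := eps ^+ 2 * r * S.
Let D : set (C * C) := J `*` setT.
Local Notation psi := (model p eps).
Local Notation epsC := (eps%:C : C).

Let rho0 : 0 < rho.
Proof. by rewrite !mulr_gt0 ?exprn_gt0//; move: r3 S1; lra. Qed.

Let rho_del : 6 * rho <= eps * del.
Proof.
have : eps * (6 * eps * r * S) <= eps * del by rewrite ler_pM2l.
by rewrite /rho expr2; lra.
Qed.

(** The fibre contraction is strong enough that the disk of radius [r] absorbs all
    points after finitely many steps. *)
Lemma model_shrink v B : J v.1 -> r <= B -> nrm v.2 < 2 * B -> nrm (psi v).2 < B.
Proof.
move=> Jv rB hv.
have q0 : 0 < nrm p^`().[v.1] by rewrite nrm_gt0 deriv_neq0.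
have h1 : nrm (epsC * v.1) <= eps * r.
  by rewrite nrmM nrm_real gtr0_norm// ler_pM2l// Jr.
have h2 : nrm (epsC ^+ 2 * v.2 / p^`().[v.1]) <= eps ^+ 2 * (2 * B) * S.
  rewrite !nrmM nrmV nrm_real gtr0_norm// ler_pdivrMr//.
  rewrite expr2 -!mulrA !(ler_pM2l eps0).
  have e1 := deriv_lb Jv.
  have e2 : 2 * B <= 2 * B * (S * nrm p^`().[v.1]) by rewrite ler_peMr//; move: r3 rB; lra.
  by move: hv e2; lra.
have h3 : eps * S * r <= 6^-1 by move: eps_del del1; lra.
have h4 : eps * r <= 1 by move: eps_r eps0; lra.
have h5 : eps * S * 3 <= eps * S * r.
  by rewrite ler_wpM2l ?mulr_ge0//; move: eps0 S1 r3; lra.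
have h6 : eps * 3 <= eps * r by rewrite ler_pM2l//; move: r3; lra.
have h7 : eps * S * (eps * (2 * B)) <= 18^-1 * (3^-1 * (2 * B)).
  have g1 : 0 <= eps * S by rewrite mulr_ge0//; move: eps0 S1; lra.
  have g2 : 0 <= eps * (2 * B) by rewrite mulr_ge0//; move: eps0 r3 rB; lra.
  apply: (ler_pM g1 g2); first by move: h3 h5; lra.
  by rewrite ler_wpM2r//; move: h4 h6 r3 rB; lra.
apply: le_lt_trans (nrmB _ _) _; apply: le_lt_trans (lerD h1 h2) _.
by move: h7 h4 r3 rB; rewrite expr2; lra.
Qed.

(** For [w] in one of the small disks making up the image of the model map in the
    fibre over [v.1], the centre of that disk is [eps z]. The radius [3 rho] leaves
    room around the image (radius [rho]) and around the support of the cutoff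
    (radius [2 rho]). *)
Definition inner_preimage v z := [/\ J z, p.[z] = v.1 & nrm (v.2 - epsC * z) < 3 * rho].

(** Distinct preimages in [J] of the same point are at distance more than [del], so
    their disks do not meet. *)
Lemma inner_preimage_uniq v z z' : inner_preimage v z -> inner_preimage v z' -> z = z'.
Proof.
move=> [Jz pz hz] [Jz' pz' hz']; apply: Julia_inj_local; rewrite ?pz'//.
rewrite -(ler_pM2l eps0).
have -> : eps * nrm (z' - z) = nrm (epsC * z' - epsC * z).
  by rewrite -mulrBr nrmM nrm_real gtr0_norm.
have := nrm_tri v.2 (epsC * z') (epsC * z); rewrite [nrm (_ - v.2)]nrmBC.
by move: hz hz' rho_del; lra.
Qed.

Lemma inner_preimage_small v z : inner_preimage v z -> nrm v.2 < 1.
Proof.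
move=> [/Jr hz _ h]; have := nrm_lb v.2 (epsC * z); rewrite nrmM nrm_real gtr0_norm//.
have : eps * nrm z <= eps * r by rewrite ler_pM2l.
have : eps * del <= eps * 1 by rewrite ler_pM2l.
by move: h rho_del eps_r eps0; lra.
Qed.

(** The inverse branch of the model map on the disk centred at [eps z]. *)
Definition inner_lift v z : C * C := (z, (epsC * z - v.2) * p^`().[z] / epsC ^+ 2).

Lemma inner_lift_model v : J v.1 -> inner_lift (psi v) v.1 = v.
Proof.
move=> /deriv_neq0 h; case: v h => z w /= h; rewrite /inner_lift /model /=; congr pair.
have e0 : epsC != 0 by rewrite -nrm_gt0 nrm_real gtr0_norm.
by field; rewrite e0 h.
Qed.

Lemma inner_preimage_model v : J v.1 -> nrm v.2 < r ->
  inner_preimage (psi v) v.1 /\ cutoff rho (nrm ((psi v).2 - epsC * v.1)) = 1.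
Proof.
move=> Jv hv.
have h : nrm ((psi v).2 - epsC * v.1) <= rho.
  rewrite /model /= addrAC subrr add0r nrmN nrmM nrmV nrmM nrmX nrm_real gtr0_norm//.
  have h1 := deriv_lb Jv.
  have q0 : 0 < nrm p^`().[v.1] by rewrite nrm_gt0 deriv_neq0.
  rewrite ler_pdivrMr// /rho expr2 -!mulrA !(ler_pM2l eps0).
  apply: le_trans (ltW hv) _; rewrite ler_peMr//; by move: r3; lra.
split; last by rewrite cutoff1.
by split=> //; move: rho0; lra.
Qed.

(** The preimage [z] is unique by [inner_preimage_uniq], so the choice is harmless;
    the cutoff makes the function vanish before [z] ceases to exist. *)
Definition inner_value (f : C * C -> C * C) v : C :=
  if pselect (exists z, inner_preimage v z) is left h then
    let z := sval (cid h) in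
    (cutoff rho (nrm (v.2 - epsC * z)))%:C * (f (inner_lift v z)).1
  else 0.

Lemma inner_valueE f v z : inner_preimage v z ->
  inner_value f v = (cutoff rho (nrm (v.2 - epsC * z)))%:C * (f (inner_lift v z)).1.
Proof.
move=> hz; rewrite /inner_value; case: pselect => [h|[]]; last by exists z.
by case: cid => z' hz' /=; rewrite (inner_preimage_uniq hz hz').
Qed.

Lemma inner_value0 f v : (forall z, ~ inner_preimage v z) -> inner_value f v = 0.
Proof. by move=> h; rewrite /inner_value; case: pselect => // hz; have [z /h []] := hz. Qed.

Variable a : C.
Hypothesis a_r : nrm a * (r + 1) <= 1.
Hypothesis aS : S * nrm a <= (mu - 1) / 4 * del.

Let aS1 : S * nrm a <= (mu - 1) / 4.
Proof.
apply: le_trans aS _; rewrite ler_piMr//; by move: mu1; lra.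
Qed.

Let a14 : nrm a <= 4^-1.
Proof.
have : nrm a * 4 <= nrm a * (r + 1) by rewrite ler_wpM2l ?nrm_ge0//; move: r3; lra.
by move: a_r; lra.
Qed.

(** Its fixed points solve [p(X) + a Y = X o psi] and, where the cutoff equals [1],
    [Y o psi = a X]. *)
Definition straighten (f : C * C -> C * C) v : C * C :=
  ((f v).1 + ((f (psi v)).1 - a * (f v).2 - p.[(f v).1]) / p^`().[v.1],
   filler v.2 + a * inner_value f v).

Definition near_id (f : C * C -> C * C) : Prop := forall v, D v ->
  sig v.1 * nrm ((f v).1 - v.1) <= del /\ nrm (f v).2 <= 2.

Definition close (t : R) (f g : C * C -> C * C) : Prop := forall v, D v ->
  sig v.1 * nrm ((f v).1 - (g v).1) <= t /\ nrm ((f v).2 - (g v).2) <= t.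

Lemma model_D v : D v -> D (psi v).
Proof.
by move=> [Jv _]; split; [exact: (Julia_step d_ge2 p_deg p_monic)|exact: I].
Qed.

Lemma model_iter_D n v : D v -> D (iter n psi v).
Proof. move=> Dv; elim: n => [|n IH]; [exact: Dv|exact: model_D]. Qed.

Lemma model_iter1 n v : (iter n psi v).1 = iter n (horner p) v.1.
Proof. by elim: n => // n IH; rewrite !iterS /= IH. Qed.

Lemma inner_lift_D v z : inner_preimage v z -> D (inner_lift v z).
Proof. by move=> [Jz _ _]; split; [exact: Jz|exact: I]. Qed.

Lemma near_id_del f v : near_id f -> D v -> nrm ((f v).1 - v.1) <= del.
Proof. by move=> hf Dv; apply: le_trans (hf v Dv).1; exact: (nrm_le_sig em). Qed.

Lemma near_id_bound f v : near_id f -> D v -> nrm (f v).1 <= r + 1.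
Proof.
move=> hf Dv; have := near_id_del hf Dv; have := nrm_lb (f v).1 v.1.
have := Jr Dv.1; move: del1; lra.
Qed.

(** The inverse of the derivative contracts by [mu] from the weight at [p z] to the
    weight at [z]. *)
Lemma linear_solve z x : J z -> forall y,
  sig z * nrm (y + x / p^`().[z]) * mu <= sig p.[z] * nrm (p^`().[z] * y + x).
Proof.
move=> Jz y; have q0 := deriv_neq0 Jz.
have -> : p^`().[z] * y + x = p^`().[z] * (y + x / p^`().[z]) by field.
rewrite nrmM mulrC !mulrA ler_wpM2r ?nrm_ge0// ; exact: (em_expand em).
Qed.

Lemma straighten_near_id f : near_id f -> near_id (straighten f).
Proof.
move=> hf v Dv; have [hX hY] := hf v Dv; have [Jv _] := Dv; split; rewrite /straighten /=.
  have m0 : 0 < mu by move: mu1; lra.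
  rewrite -(ler_pM2r m0).
  have [hX1 _] := hf _ (model_D Dv); rewrite /= in hX1.
  set X := (f v).1 in hX *; set X1 := (f (psi v)).1 in hX1 *; set Y := (f v).2 in hY *.
  have Xdel : nrm (X - v.1) <= del by exact: near_id_del.
  have dd : nrm (v.1 - v.1) <= del by rewrite subrr nrm0 ltW.
  have hq := em_quad em Jv Xdel dd.
  have := linear_solve (X1 - a * Y - p.[X]) Jv (X - v.1).
  rewrite addrAC => h; apply: le_trans h _.
  have -> : p^`().[v.1] * (X - v.1) + (X1 - a * Y - p.[X]) =
    (X1 - p.[v.1]) - a * Y - (p.[X] - p.[v.1] - p^`().[v.1] * (X - v.1)) by ring.
  set Q := p.[X] - p.[v.1] - _ in hq *.
  have Jp := Julia_step d_ge2 p_deg p_monic Jv.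
  have h1 : sig p.[v.1] * nrm (X1 - p.[v.1] - a * Y - Q) <=
     sig p.[v.1] * (nrm (X1 - p.[v.1]) + nrm (a * Y) + nrm Q).
    rewrite ler_pM2l ?(sig_gt0 em)//; apply: le_trans (nrmB _ _) _.
    by rewrite lerD2r nrmB.
  apply: le_trans h1 _; rewrite !mulrDr.
  have h2 : sig p.[v.1] * nrm (a * Y) <= S * nrm a * 2.
    apply: le_trans (sig_le_nrm em _ Jp) _; rewrite nrmM -mulrA.
    by rewrite ler_wpM2l ?ler_wpM2l ?nrm_ge0//; move: S1; lra.
  have h3 : (mu - 1) / 2 * (sig v.1 * nrm (X - v.1)) <= (mu - 1) / 2 * del.
    by rewrite ler_wpM2l//; move: mu1; lra.
  by move: h2 h3 hq hX1 aS; lra.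
have [[z hz]|hn] := pselect (exists z, inner_preimage v z); last first.
  rewrite inner_value0 ?mulr0 ?addr0 ?filler_le2// => z hz.
  by apply: hn; exists z.
rewrite filler0 ?(ltW (inner_preimage_small hz))// add0r (inner_valueE _ hz).
have Du := inner_lift_D hz.
have h1 := near_id_bound hf Du.
rewrite !nrmM nrm_real ger0_norm ?cutoff_ge0//.
have h2 : cutoff rho (nrm (v.2 - epsC * z)) * nrm (f (inner_lift v z)).1 <= 1 * (r + 1).
  by rewrite ler_pM ?cutoff_ge0 ?nrm_ge0 ?cutoff_le1.
have : nrm a * (cutoff rho (nrm (v.2 - epsC * z)) * nrm (f (inner_lift v z)).1) <=
  nrm a * (1 * (r + 1)) by rewrite ler_wpM2l ?nrm_ge0.
by move: a_r; lra.
Qed.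

Let kap := (3 * mu + 1) / (4 * mu).

Let kap01 : 0 < kap < 1.
Proof.
have m0 : 0 < 4 * mu by move: mu1; lra.
by rewrite /kap divr_gt0//= ?ltr_pdivrMr// ?mul1r; move: mu1; lra.
Qed.

Let kap34 : 3 / 4 <= kap.
Proof.
have m0 : 0 < 4 * mu by move: mu1; lra.
by rewrite /kap ler_pdivlMr//; move: mu1; lra.
Qed.

Lemma straighten_close t f g : near_id f -> near_id g -> close t f g ->
  close (kap * t) (straighten f) (straighten g).
Proof.
move=> hf hg hfg v Dv; have [Jv _] := Dv; have [hX hY] := hfg v Dv.
have t0 : 0 <= t by apply: le_trans hY; exact: nrm_ge0.
split; rewrite /straighten /=.
  have m0 : 0 < mu by move: mu1; lra.
  rewrite -(ler_pM2r m0).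
  have [hX1 _] := hfg _ (model_D Dv); rewrite /= in hX1.
  have fd := near_id_del hf Dv; have gd := near_id_del hg Dv.
  have hq := em_quad em Jv fd gd.
  set X := (f v).1 in hX hq *; set X1 := (f (psi v)).1 in hX1 *; set Y := (f v).2 in hY *.
  set Z := (g v).1 in hX hq *; set Z1 := (g (psi v)).1 in hX1 *; set W := (g v).2 in hY *.
  have := linear_solve ((X1 - a * Y - p.[X]) - (Z1 - a * W - p.[Z])) Jv (X - Z).
  have -> : X - Z + (X1 - a * Y - p.[X] - (Z1 - a * W - p.[Z])) / p^`().[v.1] =
    X + (X1 - a * Y - p.[X]) / p^`().[v.1] - (Z + (Z1 - a * W - p.[Z]) / p^`().[v.1]).
    by rewrite mulrBl; ring.
  move=> h; apply: le_trans h _.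
  have -> : p^`().[v.1] * (X - Z) + (X1 - a * Y - p.[X] - (Z1 - a * W - p.[Z])) =
    (X1 - Z1) - a * (Y - W) - (p.[X] - p.[Z] - p^`().[v.1] * (X - Z)) by ring.
  set Q := p.[X] - p.[Z] - _ in hq *.
  have Jp := Julia_step d_ge2 p_deg p_monic Jv.
  have h1 : sig p.[v.1] * nrm (X1 - Z1 - a * (Y - W) - Q) <=
     sig p.[v.1] * (nrm (X1 - Z1) + nrm (a * (Y - W)) + nrm Q).
    rewrite ler_pM2l ?(sig_gt0 em)//; apply: le_trans (nrmB _ _) _.
    by rewrite lerD2r nrmB.
  apply: le_trans h1 _; rewrite mulrDr [X in X + _ <= _]mulrDr.
  have h2 : sig p.[v.1] * nrm (a * (Y - W)) <= (mu - 1) / 4 * t.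
    apply: le_trans (sig_le_nrm em _ Jp) _; rewrite nrmM mulrA.
    apply: ler_pM => //; last exact: nrm_ge0.
    by rewrite mulr_ge0 ?nrm_ge0//; move: S1; lra.
  have h3 : (mu - 1) / 2 * (sig v.1 * nrm (X - Z)) <= (mu - 1) / 2 * t.
    by rewrite ler_wpM2l//; move: mu1; lra.
  have -> : kap * t * mu = (3 * mu + 1) / 4 * t.
    by rewrite /kap; field; move: mu1; lra.
  by move: h2 h3 hq hX1; lra.
have kt : 0 <= kap * t by rewrite mulr_ge0//; case/andP: kap01 => /ltW.
have -> : filler v.2 + a * inner_value f v - (filler v.2 + a * inner_value g v) =
  a * (inner_value f v - inner_value g v) by ring.
have [[z hz]|hn] := pselect (exists z, inner_preimage v z); last first.
  by rewrite !inner_value0 ?subrr ?mulr0 ?nrm0// => z hz; apply: hn; exists z.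
rewrite !(inner_valueE _ hz) -mulrBr !nrmM nrm_real ger0_norm ?cutoff_ge0//.
have Du := inner_lift_D hz.
have h1 := le_trans (nrm_le_sig em _ _) (hfg _ Du).1.
apply: ler_pM; rewrite ?nrm_ge0 ?mulr_ge0 ?cutoff_ge0 ?nrm_ge0//.
  by move: a14 kap34; lra.
by rewrite -[t]mul1r ler_pM ?cutoff_ge0 ?nrm_ge0 ?cutoff_le1.
Qed.

Definition cvg_on (f : C * C -> C * C) : Prop := forall v, D v ->
  f u @[u --> within D (nbhs v)] --> f v.

Lemma cvg_on_comp f (h : C * C -> C * C) v (F : set_system (C * C)) (FF : Filter F) :
  cvg_on f -> D (h v) -> h u @[u --> F] --> h v -> (\forall u \near F, D (h u)) ->
  f (h u) @[u --> F] --> f (h v).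
Proof.
move=> cf Dv ch hD P hP.
have h1 : F (fun u => D (h u) -> P (f (h u))) := ch _ (cf _ Dv P hP).
by apply: filterS2 h1 hD => u h2 h3; apply: h2.
Qed.

Lemma within_D v : \forall u \near within D (nbhs v), D u.
Proof. by apply: withinT. Qed.

Lemma within_nrm v (P : set (C * C)) :
  (exists2 h : R, 0 < h & forall u, D u -> nrm (v.1 - u.1) < h ->
    nrm (v.2 - u.2) < h -> P u) -> within D (nbhs v) P.
Proof.
move=> [h h0 hP]; apply/nbhs_nrm2; exists h => // u h1 h2 Du; exact: hP.
Qed.

Lemma inner_preimage_near v z : inner_preimage v z -> forall e, 0 < e ->
  \forall u \near within D (nbhs v),
    exists2 w, inner_preimage u w & nrm (z - w) < e.
Proof.
move=> [Jz pz hz] e e0; apply: within_nrm.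
pose g := 3 * rho - nrm (v.2 - epsC * z).
have g0 : 0 < g by rewrite subr_gt0.
pose e1 := Num.min e (g / 2 / eps).
have e10 : 0 < e1 by rewrite lt_min e0 !divr_gt0.
exists (Num.min (e1 ^+ d) (g / 2)); first by rewrite lt_min exprn_gt0// divr_gt0.
move=> u [Ju _]; rewrite !lt_min => /andP[hu1 _] /andP[_ hu2].
have [w pw hw] := poly_root_near (ltnW d_ge2) p_deg p_monic z u.1.
have zw : nrm (z - w) < e1.
  rewrite -(@ltr_pXn2r _ d) ?nnegrE ?nrm_ge0 ?(ltW e10)//; last exact: ltnW.
  by apply: le_lt_trans hw _; rewrite pz.
exists w; last by apply: lt_le_trans zw _; rewrite ge_min lexx.
have Jw : J w by apply/(Julia_horner d_ge2 p_deg p_monic); rewrite pw; exact: Ju.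
split; [exact: Jw|exact: pw|].
have h1 : eps * nrm (z - w) <= g / 2.
  rewrite mulrC -ler_pdivlMr//; apply: le_trans (ltW zw) _.
  by rewrite ge_min lexx orbT.
have h2 : nrm (epsC * z - epsC * w) = eps * nrm (z - w).
  by rewrite -mulrBr nrmM nrm_real gtr0_norm.
have := nrm_tri v.2 u.2 (epsC * w); rewrite [nrm (u.2 - v.2)]nrmBC.
have := nrm_tri (epsC * z) v.2 (epsC * w); rewrite h2.
by move: h1 hu2; rewrite /g; lra.
Qed.

Lemma inner_value_near0 f v : D v -> (forall z, ~ inner_preimage v z) ->
  \forall u \near within D (nbhs v), inner_value f u = 0.
Proof.
move=> [Jv _] nz; apply: within_nrm.
pose e1 := rho / 2 / eps.
have e10 : 0 < e1 by rewrite !divr_gt0.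
exists (Num.min (e1 ^+ d) (rho / 2)); first by rewrite lt_min exprn_gt0// divr_gt0.
move=> u [Ju _]; rewrite !lt_min => /andP[hu1 _] /andP[_ hu2].
have [[z hz]|hn] := pselect (exists z, inner_preimage u z); last first.
  by rewrite inner_value0// => z hz; apply: hn; exists z.
rewrite (inner_valueE _ hz).
have [far|close] := leP (2 * rho) (nrm (u.2 - epsC * z)).
  by rewrite cutoff0// mul0r.
have [Jz pz _] := hz.
have [w pw hw] := poly_root_near (ltnW d_ge2) p_deg p_monic z v.1.
have zw : nrm (z - w) < e1.
  rewrite -(@ltr_pXn2r _ d) ?nnegrE ?nrm_ge0 ?(ltW e10)//; last exact: ltnW.
  by apply: le_lt_trans hw _; rewrite pz nrmBC.
have Jw : J w by apply/(Julia_horner d_ge2 p_deg p_monic); rewrite pw; exact: Jv.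
case: (nz w); split; [exact: Jw|exact: pw|].
have h1 : eps * nrm (z - w) <= rho / 2 by rewrite mulrC -ler_pdivlMr// ltW.
have h2 : nrm (epsC * z - epsC * w) = eps * nrm (z - w).
  by rewrite -mulrBr nrmM nrm_real gtr0_norm.
have := nrm_tri u.2 v.2 (epsC * w).
have := nrm_tri (epsC * z) u.2 (epsC * w); rewrite h2.
by move: h1 hu2 close; lra.
Qed.

(** Near a point with an inner preimage the preimage moves continuously, by
    [poly_root_near] and uniqueness; near the other points the cutoff vanishes. *)
Lemma inner_value_cvg f v : cvg_on f -> D v ->
  inner_value f u @[u --> within D (nbhs v)] --> inner_value f v.
Proof.
move=> cf Dv; have [[z hz]|hn] := pselect (exists z, inner_preimage v z); last first.
  have nz z : ~ inner_preimage v z by move=> hz; apply: hn; exists z.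
  rewrite (inner_value0 _ nz); apply/cvg_nrm => e e0.
  apply: filterS (inner_value_near0 f Dv nz) => u ->.
  by rewrite subrr nrm0.
pose s u : C := xget 0 (inner_preimage u).
have near_s : \forall u \near within D (nbhs v), inner_preimage u (s u).
  apply: filterS (inner_preimage_near hz ltr01) => u [w hw _].
  exact: xgetPex (ex_intro _ w hw).
have sv : s v = z.
  have h : inner_preimage v (s v) by exact: xgetPex (ex_intro _ z hz).
  exact: inner_preimage_uniq h hz.
have cs : s u @[u --> within D (nbhs v)] --> s v.
  apply/cvg_nrm => e e0.
  apply: filterS2 near_s (inner_preimage_near hz e0) => u hu [w hw].
  by rewrite sv (inner_preimage_uniq hu hw).
have cid2 : u @[u --> within D (nbhs v)] --> v.
  exact: (@cvg_within _ (nbhs v) (nbhs_filter v) D).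
have c2 : u.2 @[u --> within D (nbhs v)] --> v.2 by apply: cvg_comp cid2 cvg_snd.
have c3 : u.2 - epsC * s u @[u --> within D (nbhs v)] --> v.2 - epsC * s v.
  exact: (cvgB c2 (cvgMr cs)).
have c4 : (epsC * s u - u.2) * p^`().[s u] / epsC ^+ 2 @[u --> within D (nbhs v)] -->
  (epsC * s v - v.2) * p^`().[s v] / epsC ^+ 2.
  exact: (cvgMl (cvgM (cvgB (cvgMr cs) c2) (horner_cvg _ cs))).
have c5 : inner_lift u (s u) @[u --> within D (nbhs v)] --> inner_lift v (s v).
  exact: (cvg_pair_nrm _ cs c4).
have Dl : D (inner_lift v (s v)) by rewrite sv; exact: inner_lift_D.
have c6 : f (inner_lift u (s u)) @[u --> within D (nbhs v)] --> f (inner_lift v (s v)).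
  apply: (cvg_on_comp (h := fun u => inner_lift u (s u)) _ cf Dl c5).
  by apply: filterS near_s => u; exact: inner_lift_D.
have c7 : (f (inner_lift u (s u))).1 @[u --> within D (nbhs v)] --> (f (inner_lift v (s v))).1.
  by apply: cvg_comp c6 cvg_fst.
have FF : Filter (within D (nbhs v)) := within_filter D (nbhs_filter v).
have c8 := (cvg_nrm FF _ _).1 (cvgM (cutoff_cvg FF rho0 c3) c7).
rewrite (inner_valueE _ hz) -sv; apply/cvg_nrm => e e0.
by apply: filterS2 (c8 FF e e0) near_s => u h1 h2; rewrite (inner_valueE _ h2).
Qed.

Lemma model_cvg : cvg_on psi.
Proof.
move=> v [Jv _].
have cid2 : u @[u --> within D (nbhs v)] --> v.
  exact: (@cvg_within _ (nbhs v) (nbhs_filter v) D).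
have c1 : u.1 @[u --> within D (nbhs v)] --> v.1 by apply: cvg_comp cid2 cvg_fst.
have c2 : u.2 @[u --> within D (nbhs v)] --> v.2 by apply: cvg_comp cid2 cvg_snd.
have cq : p^`().[u.1]^-1 @[u --> within D (nbhs v)] --> p^`().[v.1]^-1.
  exact: (cvgV (deriv_neq0 Jv) (horner_cvg _ c1)).
apply: (cvg_pair_nrm _ (horner_cvg _ c1)).
exact: (cvgB (cvgMr c1) (cvgM (cvgMr c2) cq)).
Qed.

Lemma model_iter_cvg n : cvg_on (iter n psi).
Proof.
elim: n => [|n IH] v Dv.
  exact: (@cvg_within _ (nbhs v) (nbhs_filter v) D).
have h : psi (iter n psi u) @[u --> within D (nbhs v)] --> psi (iter n psi v).
  apply: (cvg_on_comp _ model_cvg _ (IH v Dv)); first exact: model_iter_D.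
  by apply: filterS (within_D v) => u; exact: model_iter_D.
exact: h.
Qed.

Lemma straighten_cvg f : cvg_on f -> cvg_on (straighten f).
Proof.
move=> cf v Dv; have [Jv _] := Dv.
have cid2 : u @[u --> within D (nbhs v)] --> v.
  exact: (@cvg_within _ (nbhs v) (nbhs_filter v) D).
have c1 : u.1 @[u --> within D (nbhs v)] --> v.1 by apply: cvg_comp cid2 cvg_fst.
have c2 : u.2 @[u --> within D (nbhs v)] --> v.2 by apply: cvg_comp cid2 cvg_snd.
have cq : p^`().[u.1]^-1 @[u --> within D (nbhs v)] --> p^`().[v.1]^-1.
  exact: (cvgV (deriv_neq0 Jv) (horner_cvg _ c1)).
have cpsi := model_cvg Dv.
have cf1 := cf v Dv.
have f1 : (f u).1 @[u --> within D (nbhs v)] --> (f v).1 by apply: cvg_comp cf1 cvg_fst.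
have f2 : (f u).2 @[u --> within D (nbhs v)] --> (f v).2 by apply: cvg_comp cf1 cvg_snd.
have cf3 : f (psi u) @[u --> within D (nbhs v)] --> f (psi v).
  apply: (cvg_on_comp (h := psi) _ cf (model_D Dv) cpsi).
  by apply: filterS (within_D v) => u; exact: model_D.
have f3 : (f (psi u)).1 @[u --> within D (nbhs v)] --> (f (psi v)).1.
  by apply: cvg_comp cf3 cvg_fst.
apply: (cvg_pair_nrm _ (cvgD f1 (cvgM (cvgB (cvgB f3 (cvgMr f2)) (horner_cvg _ f1)) cq))).
exact: (cvgD (filler_cvg _ c2) (cvgMr (inner_value_cvg cf Dv))).
Qed.

(** Uniform limit of the iterates of [straighten], starting from [v |-> (v.1, 0)]. *)
Lemma straighten_fixpoint :
  exists f, [/\ near_id f, cvg_on f & forall v, D v -> straighten f v = f v].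
Proof.
have /andP[k0 k1] := kap01.
pose f n := iter n straighten (fun v : C * C => (v.1, 0 : C)).
have fS n : f n.+1 = straighten (f n) by [].
have nf n : near_id (f n).
  elim: n => [|n IH]; last exact: straighten_near_id IH.
  by move=> v _; rewrite /f /= subrr nrm0 mulr0; split; [exact: ltW|].
have cf n : cvg_on (f n).
  elim: n => [|n IH]; last exact: straighten_cvg IH.
  move=> v _; apply: (@cvg_pair_nrm _ _ _ _ fst (fun=> 0)); last exact: cvg_cst.
  have cid2 : u @[u --> within D (nbhs v)] --> v.
    exact: (@cvg_within _ (nbhs v) (nbhs_filter v) D).
  by apply: cvg_comp cid2 cvg_fst.
have df n : close (2 * kap ^+ n) (f n.+1) (f n).
  elim: n => [|n IH].
    move=> v Dv; have [h1 h2] := nf 1%N v Dv.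
    rewrite expr0 mulr1; split.
      by apply: le_trans h1 _; move: del1; lra.
    by have -> : (f 0%N v).2 = 0 by []; rewrite subr0.
  have := straighten_close (nf n.+1) (nf n) IH.
  by rewrite mulrCA -exprS.
have [F hF] : exists F : C * C -> C * C, forall v, D v -> forall n,
    nrm ((F v).1 - (f n v).1) <= 2 / (1 - kap) * kap ^+ n /\
    nrm ((F v).2 - (f n v).2) <= 2 / (1 - kap) * kap ^+ n.
  have /choice[F hF] : forall v, exists l : C * C, D v -> forall n,
      nrm (l.1 - (f n v).1) <= 2 / (1 - kap) * kap ^+ n /\
      nrm (l.2 - (f n v).2) <= 2 / (1 - kap) * kap ^+ n.
    move=> v; have [Dv|nD] := pselect (D v); last by exists v.
    have [||n|x hx] := @nrm_geometric_cvg R (fun n => (f n v).1) 2 kap.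
    - by [].
    - by rewrite k0 k1.
    - exact: le_trans (nrm_le_sig em _ _) (df n v Dv).1.
    have [||n|y hy] := @nrm_geometric_cvg R (fun n => (f n v).2) 2 kap.
    - by [].
    - by rewrite k0 k1.
    - exact: (df n v Dv).2.
    by exists (x, y) => _ n; split; [exact: hx|exact: hy].
  by exists F.
pose B := S * (2 / (1 - kap)).
have b0 : 0 <= 2 / (1 - kap) by rewrite divr_ge0// subr_ge0 ltW.
have cF n : close (B * kap ^+ n) F (f n).
  move=> v Dv; have [h1 h2] := hF v Dv n.
  have S0 : 0 <= S by move: S1; lra.
  split; rewrite -mulrA.
    by apply: le_trans (sig_le_nrm em _ Dv.1) _; rewrite ler_wpM2l.
  apply: le_trans h2 _; rewrite ler_peMl// mulr_ge0// exprn_ge0// ltW//.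
have small e : 0 < e -> exists n, B * kap ^+ n < e.
  move=> e0; have [|n hn] := @geometric_exceeds R e kap^-1 e0 _ B.
    by rewrite invf_gt1.
  by exists n; rewrite -ltr_pdivlMr ?exprn_gt0// -exprVn.
have nF : near_id F.
  move=> v Dv; split; apply/ler_addgt0Pr => e e0; have [n hn] := small e e0;
    have [h1 h2] := cF n v Dv; have [h3 h4] := nf n v Dv.
    have h : sig v.1 * nrm ((F v).1 - v.1) <=
        sig v.1 * (nrm ((F v).1 - (f n v).1) + nrm ((f n v).1 - v.1)).
      by rewrite ler_pM2l ?(sig_gt0 em)// nrm_tri.
    by move: h h1 h3 hn; rewrite mulrDr; lra.
  by have := nrm_lb (F v).2 (f n v).2; move: h2 h4 hn; lra.
exists F; split; first exact: nF.
  move=> v Dv P /nbhs_nrm2 [e e0 he].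
  have e30 : 0 < e / 3 by rewrite divr_gt0.
  have [n hn] := small _ e30.
  have hnear : nbhs (f n v) (fun u => nrm ((f n v).1 - u.1) < e / 3 /\
      nrm ((f n v).2 - u.2) < e / 3).
    by apply/nbhs_nrm2; exists (e / 3).
  have h : \forall u \near within D (nbhs v),
    nrm ((f n v).1 - (f n u).1) < e / 3 /\ nrm ((f n v).2 - (f n u).2) < e / 3.
    exact: (cf n v Dv _ hnear).
  have wD := within_D v.
  rewrite /nbhs /=; apply: filterS2 h wD => u [h1 h2] Du.
  have a1 := le_trans (nrm_le_sig em _ _) (cF n v Dv).1.
  have a2 := (cF n v Dv).2.
  have a3 := le_trans (nrm_le_sig em _ _) (cF n u Du).1.
  have a4 := (cF n u Du).2.
  apply: he.
    have := nrm_tri (f n v).1 (F v).1 (F u).1.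
    have := nrm_tri (f n u).1 (f n v).1 (F u).1; rewrite [nrm ((f n u).1 - _)]nrmBC.
    by move: h1 a1 a3 hn; lra.
  have := nrm_tri (f n v).2 (F v).2 (F u).2.
  have := nrm_tri (f n u).2 (f n v).2 (F u).2; rewrite [nrm ((f n u).2 - _)]nrmBC.
  by move: h2 a2 a4 hn; lra.
move=> v Dv.
have eq0 e : 0 < e -> nrm ((straighten F v).1 - (F v).1) <= e /\
    nrm ((straighten F v).2 - (F v).2) <= e.
  move=> e0; have e20 : 0 < e / 2 by rewrite divr_gt0.
  have [n hn] := small _ e20.
  have [h1 h2] := straighten_close nF (nf n) (cF n) Dv.
  have [h3 h4] := cF n.+1 v Dv; rewrite fS in h3 h4.
  have kB : kap * (B * kap ^+ n) <= B * kap ^+ n.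
    have : 0 <= B * kap ^+ n.
      by rewrite mulr_ge0 ?exprn_ge0 ?(ltW k0)// mulr_ge0//; move: S1; lra.
    by move: k0 k1 => ? ? ?; rewrite ler_piMl// ltW.
  have kB2 : B * kap ^+ n.+1 <= B * kap ^+ n by rewrite exprS mulrCA.
  have {}h1 := le_trans (nrm_le_sig em _ _) h1.
  have {}h3 := le_trans (nrm_le_sig em _ _) h3.
  split.
    have := nrm_tri (straighten (f n) v).1 (straighten F v).1 (F v).1.
    by rewrite [nrm ((straighten (f n) v).1 - _)]nrmBC; move: h1 h3 kB kB2 hn; lra.
  have := nrm_tri (straighten (f n) v).2 (straighten F v).2 (F v).2.
  by rewrite [nrm ((straighten (f n) v).2 - _)]nrmBC; move: h2 h4 kB kB2 hn; lra.
have e1 : (straighten F v).1 - (F v).1 = 0 by apply: nrm_small0 => e /eq0 [].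
have e2 : (straighten F v).2 - (F v).2 = 0 by apply: nrm_small0 => e /eq0 [].
rewrite [LHS]surjective_pairing [RHS]surjective_pairing.
by congr pair; apply/eqP; rewrite -subr_eq0 ?e1 ?e2.
Qed.

Lemma local_semiconjugacy : exists f : C * C -> C * C, [/\
  forall v, D v -> nrm ((f v).1 - v.1) <= del /\ nrm (f v).2 <= 2,
  cvg_on f,
  forall v, D v -> nrm v.2 < r -> henon p a (f v) = f (psi v) &
  forall z y, J z -> nrm y <= 1 -> exists2 w, nrm w < 3 & (f (z, w)).2 = y].
Proof.
have [f [nf cf hf]] := straighten_fixpoint; exists f; split.
- by move=> v Dv; split; [exact: near_id_del|exact: (nf v Dv).2].
- exact: cf.
- move=> v Dv vr; have [Jv _] := Dv; rewrite /henon [RHS]surjective_pairing; congr pair.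
    have /(congr1 fst) := hf v Dv; rewrite /straighten /= => /eqP.
    rewrite -subr_eq0 addrAC subrr add0r mulf_eq0 invr_eq0 (negPf (deriv_neq0 Jv)) orbF.
    by rewrite -addrA -opprD subr_eq0 addrC => /eqP.
  rewrite -(hf _ (model_D Dv)) /straighten /=.
  have [hi hc] := inner_preimage_model Jv vr.
  rewrite filler0 ?(ltW (inner_preimage_small hi))// add0r.
  by rewrite (inner_valueE _ hi) hc mul1r inner_lift_model.
- move=> z y Jz hy; have [w [w1 w3 hw]] := filler_onto hy.
  exists w => //; have Dzw : D (z, w) by split; [exact: Jz|exact: I].
  rewrite -(hf _ Dzw) /straighten /= inner_value0 ?mulr0 ?addr0// => x hx.
  by have := inner_preimage_small hx => /=; lra.
Qed.

End Contraction.

(** * Extension to all fibres *)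

Section Globalisation.
Variables (R : realType) (d : nat) (p : {poly Cplx R}).
Hypotheses (d_ge2 : (2 <= d)%N) (p_deg : size p = d.+1) (p_monic : p \is monic).
Variables (sig : Cplx R -> R) (mu S del : R).
Hypothesis em : expanding_metric p sig mu S del.
Local Notation C := (Cplx R).
Local Notation J := (Julia p).
Implicit Types (z w x y : C) (v u : C * C).

Let del1 : del <= 1. Proof. by have /andP[] := em_del em. Qed.
Let mu1 : 1 < mu. Proof. exact: em_mu em. Qed.
Let S1 : 1 <= S. Proof. exact: em_S em. Qed.

Variables (r eps : R).
Hypothesis r3 : 3 < r.
Hypothesis Jr : forall z, J z -> nrm z <= r.
Hypothesis eps0 : 0 < eps.
Hypothesis eps_del : 6 * eps * r * S <= del.
Hypothesis eps_r : eps * (r + 1) <= 1.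

Let D : set (C * C) := J `*` setT.
Local Notation psi := (model p eps).

Let r0 : 0 < r. Proof. by move: r3; lra. Qed.

Lemma model_iter_small n v : D v -> nrm v.2 < r * 2 ^+ n -> nrm (iter n psi v).2 < r.
Proof.
elim: n v => [|n IH] v Dv; first by rewrite expr0 mulr1.
move=> hv; rewrite iterSr; apply: IH; first exact: (model_D d_ge2 p_deg p_monic).
apply: (model_shrink d_ge2 p_deg p_monic em r3 Jr eps0 eps_del eps_r Dv.1).
  by rewrite ler_peMr ?(ltW r0)// exprn_ege1// ler1n.
by rewrite mulrCA -exprS.
Qed.

Lemma model_surj v : D v -> exists2 u, D u & psi u = v.
Proof.
case: v => z w [/= Jz _].
have [x px _] := poly_root_near (ltnW d_ge2) p_deg p_monic 0 z.
have Jx : J x by apply/(Julia_horner d_ge2 p_deg p_monic); rewrite px; exact: Jz.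
have q0 := deriv_neq0 d_ge2 p_deg p_monic em Jx.
have e0 : (eps%:C : C) != 0 by rewrite -nrm_gt0 nrm_real gtr0_norm.
exists (x, (eps%:C * x - w) * p^`().[x] / eps%:C ^+ 2).
  by split; [exact: Jx|exact: I].
rewrite /model /= px; congr pair.
by field; rewrite e0 q0.
Qed.

Lemma model_iter_surj n v : D v -> exists2 u, D u & iter n psi u = v.
Proof.
elim: n v => [|n IH] v Dv; first by exists v.
have [u Du <-] := model_surj Dv; have [t Dt <-] := IH u Du.
by exists t; rewrite ?iterS.
Qed.

Variable a : C.
Hypothesis a0 : a != 0.
Local Notation H := (henon p a).
Local Notation Hi := (henon_inv p a).

Section Extension.
Variable f : C * C -> C * C.
Hypothesis f_cvg : cvg_on p f.
Hypothesis f_conj : forall v, D v -> nrm v.2 < r -> H (f v) = f (psi v).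

Lemma local_conj_iter k v : D v -> nrm v.2 < r -> iter k H (f v) = f (iter k psi v).
Proof.
move=> Dv hv; elim: k => [|k IH]; first exact: erefl.
have Dk := model_iter_D d_ge2 p_deg p_monic eps k Dv.
have hk : nrm (iter k psi v).2 < r.
  apply: (model_iter_small Dv); apply: lt_le_trans hv _.
  by rewrite ler_peMr ?(ltW r0)// exprn_ege1// ler1n.
rewrite !iterS IH (f_conj Dk hk); exact: erefl.
Qed.

(** Conjugates [f] back from the [n]-th iterate; [ext_at_add] says that the result
    does not depend on [n] once [psi^n v] has entered the disk of radius [r]. *)
Definition ext_at n v := iter n Hi (f (iter n psi v)).

Lemma ext_at_add n k v : D v -> nrm v.2 < r * 2 ^+ n -> ext_at (k + n) v = ext_at n v.
Proof.
move=> Dv hv; rewrite /ext_at [iter _ psi v]iterD.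
have Dn := model_iter_D d_ge2 p_deg p_monic eps n Dv.
rewrite -(local_conj_iter k Dn (model_iter_small Dv hv)) addnC iterD.
by rewrite henon_inv_iterK.
Qed.

Lemma scale_exists w : exists n, nrm w < r * 2 ^+ n.
Proof. exact: (geometric_exceeds r0 (ltr1n R 2)). Qed.

Definition extension v := ext_at (sval (cid (scale_exists v.2))) v.

Lemma scale_mono (x : R) m n : (m <= n)%N -> x < r * 2 ^+ m -> x < r * 2 ^+ n.
Proof.
move=> mn h; apply: lt_le_trans h _; rewrite ler_pM2l// ler_weXn2l//.
by rewrite ler1n.
Qed.

Lemma extensionE n v : D v -> nrm v.2 < r * 2 ^+ n -> extension v = ext_at n v.
Proof.
move=> Dv hv; rewrite /extension; case: cid => m /= hm.
have [mn|/ltnW nm] := leqP m n.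
  by rewrite -(subnK mn) (ext_at_add _ Dv hm).
by rewrite -(subnK nm) (ext_at_add _ Dv hv).
Qed.

Lemma extension_conj v : D v -> H (extension v) = extension (psi v).
Proof.
move=> Dv; have [m hm] := scale_exists v.2; have [n hn] := scale_exists (psi v).2.
have hm' := scale_mono (leq_trans (leq_addr n m) (leqnSn _)) hm.
have hn' := scale_mono (leq_addl m n) hn.
have Dp := model_D d_ge2 p_deg p_monic eps Dv.
by rewrite (extensionE Dv hm') (extensionE Dp hn') /ext_at iterS henon_invK// -iterSr.
Qed.

Lemma ext_at_cvg n : cvg_on p (ext_at n).
Proof.
move=> v Dv.
have h : f (iter n psi u) @[u --> within D (nbhs v)] --> f (iter n psi v).
  apply: (cvg_on_comp _ f_cvg _ (model_iter_cvg d_ge2 p_deg p_monic em Dv)).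
    exact: (model_iter_D d_ge2 p_deg p_monic).
  apply: filterS (within_D p v) => u; exact: (model_iter_D d_ge2 p_deg p_monic).
have FF : Filter (within D (nbhs v)) := within_filter D (nbhs_filter v).
suff key k : iter k Hi (f (iter n psi u)) @[u --> within D (nbhs v)] -->
    iter k Hi (f (iter n psi v)) by exact: (key n).
elim: k => [|k IH]; first exact: h.
exact: (henon_inv_cvg FF IH).
Qed.

Lemma extension_cvg : cvg_on p extension.
Proof.
move=> v Dv P; have [n hn] := scale_exists v.2.
rewrite (extensionE Dv hn) => hP.
have h : \forall u \near within D (nbhs v), P (ext_at n u) := ext_at_cvg Dv hP.
have h2 : \forall u \near within D (nbhs v), nrm u.2 < r * 2 ^+ n.
  apply: within_nrm; exists (r * 2 ^+ n - nrm v.2); first by rewrite subr_gt0.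
  by move=> u _ _; have := nrm_lb u.2 v.2; rewrite nrmBC; lra.
have h3 : \forall u \near within D (nbhs v), P (extension u).
  apply: filterS3 h h2 (within_D p v) => u h4 h5 Du.
  by rewrite (extensionE Du h5).
exact: h3.
Qed.

End Extension.

Variable t : R.
Hypothesis t_del : (mu + 1) / 2 * t <= del ^+ d.
Hypothesis t_del2 : 2 * t <= del.
Hypothesis a_r : nrm a * (r + 1) <= 1.
Hypothesis aS : S * nrm a <= (mu - 1) / 4 * del.
Hypothesis aSt : S * nrm a <= (mu - 1) / 2 * t.
Hypothesis escape :
  ~` Kplus p a = \bigcup_k (iter k (henon p a) @^-1` escape_region r).
Hypothesis Jplus_near : forall v, Jplus p a v -> exists n0, forall n, (n0 <= n)%N ->
  Julia_near p sig t (iter n H v).1 /\ nrm (iter n H v).2 <= 1.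

(** For surjectivity, an orbit of [J+] is followed until it is on the image of [f],
    and the corresponding point is then pulled back by the surjective model map. *)
Lemma global_semiconjugacy :
  exists Psi, semiconjugacy D psi (Jplus p a) H Psi.
Proof.
have a4 : nrm a <= 4^-1.
  have : nrm a * 4 <= nrm a * (r + 1) by rewrite ler_wpM2l ?nrm_ge0//; move: r3; lra.
  by move: a_r; lra.
have a1 : nrm a <= 1 by move: a4; lra.
have a2 : nrm a <= 2^-1 by move: a4; lra.
have aS1 : S * nrm a <= (mu - 1) / 4.
  by apply: le_trans aS _; rewrite ler_piMr//; move: mu1; lra.
have [f [fid fc fconj fonto]] :=
  local_semiconjugacy d_ge2 p_deg p_monic em r3 Jr eps0 eps_del eps_r a_r aS.
have fit := local_conj_iter fconj.
have fshadow v n : D v -> nrm v.2 < r -> nrm ((iter n H (f v)).1 - iter n (horner p) v.1) <= del.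
  move=> Dv hv; rewrite (fit _ _ Dv hv) -(model_iter1 p eps).
  by have [] := fid _ (model_iter_D d_ge2 p_deg p_monic eps n Dv).
have fJ v : D v -> nrm v.2 < r -> Jplus p a (f v).
  move=> Dv hv; have f2 u : D u -> nrm (f u).2 <= r.
    by move=> Du; have [_ h] := fid u Du; move: h r3; lra.
  have bnd n : nrm (iter n H (f v)).1 <= r + 1.
    have Jn := Julia_iter d_ge2 p_deg p_monic n Dv.1.
    have := fshadow v n Dv hv; have := Jr Jn.
    have := nrm_lb (iter n H (f v)).1 (iter n (horner p) v.1).
    by move: del1; lra.
  split.
    apply: subset_closure; apply/KplusP; exists (r + 1) => n; split; first exact: bnd.
    rewrite (fit _ _ Dv hv); have := f2 _ (model_iter_D d_ge2 p_deg p_monic eps n Dv).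
    lra.
  apply: (shadow_not_interior d_ge2 p_deg p_monic em a1 aS1 (r := r) _ Dv.1).
  - by move=> u Ku u2 n; have [] := Kplus_bidisk r0 a2 escape Ku u2 n.
  - exact: f2.
  - by move=> n; exact: fshadow.
exists (extension f); split.
- by move=> v Dv; exact: (model_D d_ge2 p_deg p_monic).
- by move=> v Jv; apply/Jplus_henon.
- exact/subspace_continuousP/extension_cvg.
- apply/seteqP; split=> [_ [v Dv <-]|v Jv].
    have [n hn] := scale_exists v.2.
    rewrite (extensionE fconj Dv hn); apply/(Jplus_iter p a0 n).
    rewrite /ext_at (henon_iterK p a0); apply: fJ.
      exact: (model_iter_D d_ge2 p_deg p_monic).
    exact: (model_iter_small Dv hn).
  have [n0 hn0] := Jplus_near Jv.
  pose u := iter n0 H v.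
  have un n : iter n H u = iter (n + n0) H v by rewrite iterD.
  have [||z Jz hz] := @shadowing _ _ _ d_ge2 p_deg p_monic _ _ _ _ em t
      (fun n => (iter n H u).1) t_del t_del2.
  + by move=> n; rewrite un; have [] := hn0 (n + n0)%N (leq_addl _ _).
  + move=> n; rewrite iterS /= opprD addrA subrr add0r nrmN nrmM un.
    have [_ h] := hn0 (n + n0)%N (leq_addl _ _).
    apply: le_trans aSt; rewrite mulrA ler_piMr// mulr_ge0 ?nrm_ge0//.
    by move: S1; lra.
  have [_ u1] := hn0 n0 (leqnn _).
  have [w w3 hw] := fonto z u.2 Jz u1.
  have Dzw : D (z, w) by split; [exact: Jz|exact: I].
  have wr : nrm w < r by move: w3 r3; lra.
  have fu : f (z, w) = u.
    apply: (shadow_unique d_ge2 p_deg p_monic em a1 aS1 Jz hw) => n; last exact: hz.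
    exact: (fshadow (z, w) n Dzw wr).
  have [v' Dv' hv'] := model_iter_surj n0 Dzw.
  exists v'; first exact: Dv'.
  have [m hm] := scale_exists v'.2.
  rewrite (extensionE fconj Dv' (scale_mono (leq_addr n0 m) hm)) /ext_at.
  rewrite [iter _ psi v']iterD hv' -(fit _ _ Dzw wr) fu /u -iterD (henon_inv_iterK p a0).
  exact: erefl.
- move=> v Dv; exact: (extension_conj fconj Dv).
Qed.

End Globalisation.

Theorem theorem5p3 (R : realType) (d : nat) (p : {poly Cplx R}) (r : R)
    (d_ge2 : (2 <= d)%N) (p_deg : size p = d.+1) (p_monic : p \is monic)
    (p_hyp : hyperbolic p) (J_conn : connected (Julia p))
    (r_adm : admissible_radius p r) :
  exists2 eps0 : R, 0 < eps0 &
    forall eps : R, 0 < eps < eps0 ->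
      set_fun (Julia p `*` disk r) (Julia p `*` disk r) (model p eps) /\
      exists2 a0 : R, 0 < a0 &
        forall a : Cplx R, 0 < `|a| < a0%:C ->
          exists Psi : Cplx R * Cplx R -> Cplx R * Cplx R,
            semiconjugacy (Julia p `*` setT) (model p eps)
                          (Jplus p a) (henon p a) Psi.
Proof.
have [sig [mu [S [del em]]]] := hyperbolic_metric d_ge2 p_deg p_monic p_hyp.
have [r3 Jdisk [b b0 hadm]] := r_adm.
have /andP[del0 del1] := em_del em; have mu1 := em_mu em; have S1 := em_S em.
have r0 : 0 < r by lra.
have Jr z : Julia p z -> nrm z <= r.
  by move/Jdisk; rewrite /disk /= normE ltcR => /ltW.
have rS0 : 0 < 6 * r * S by rewrite !mulr_gt0//; lra.
have r10 : 0 < r + 1 by lra.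
exists (Num.min (del / (6 * r * S)) (r + 1)^-1).
  by rewrite lt_min divr_gt0// invr_gt0.
move=> eps /andP[eps0]; rewrite lt_min => /andP[he1 he2].
have eps_del : 6 * eps * r * S <= del.
  by move: he1; rewrite ltr_pdivlMr// => /ltW; lra.
have eps_r : eps * (r + 1) <= 1.
  by rewrite -ler_pdivlMr// mul1r ltW.
split.
  move=> v [Jv]; rewrite /disk /= normE ltcR => hv; split.
    exact: (Julia_step d_ge2 p_deg p_monic).
  rewrite /disk /= normE ltcR.
  apply: (model_shrink d_ge2 p_deg p_monic em r3 Jr eps0 eps_del eps_r Jv (lexx r)).
  by move: hv r0; lra.
(* nearness to J at this scale can be pulled back and shadowed within del *)
pose t := Num.min (del / 2) (del ^+ d / ((mu + 1) / 2)).
have m0 : 0 < (mu + 1) / 2 by lra.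
have t0 : 0 < t.
  rewrite lt_min (divr_gt0 del0 (ltr0Sn _ 1)) /=.
  exact: divr_gt0 (exprn_gt0 d del0) m0.
have t_del2 : 2 * t <= del.
  have : t <= del / 2 by rewrite ge_min lexx.
  lra.
have t_del : (mu + 1) / 2 * t <= del ^+ d.
  by rewrite mulrC -ler_pdivlMr// ge_min lexx orbT.
have [c c0 hc] := Jplus_eventually_near d_ge2 p_deg p_monic em r0 t0 t_del.
have S0 : 0 < S by lra.
have md0 : 0 < (mu - 1) / 4 * del / S by rewrite divr_gt0// mulr_gt0//; lra.
have mt0 : 0 < (mu - 1) / 2 * t / S by rewrite divr_gt0// mulr_gt0//; lra.
exists (Num.min (Num.min b c) (Num.min (r + 1)^-1
    (Num.min ((mu - 1) / 4 * del / S) ((mu - 1) / 2 * t / S)))).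
  by rewrite !lt_min b0 c0 invr_gt0 r10 md0 mt0.
move=> a /andP[a0]; rewrite normE ltcR !lt_min.
move=> /andP[/andP[ab ac] /andP[ar /andP[amd amt]]].
have an0 : a != 0 by rewrite -normr_gt0.
have nb : 0 < `|a| < b%:C by rewrite a0 normE ltcR.
have [_ escape] := hadm a nb.
have na0 : 0 < nrm a by rewrite nrm_gt0.
apply: (global_semiconjugacy d_ge2 p_deg p_monic em r3 Jr eps0 eps_del eps_r an0
  t_del t_del2 _ _ _ escape (hc a na0 ac escape)).
- by rewrite -ler_pdivlMr// mul1r ltW.
- by rewrite mulrC -ler_pdivlMr// ltW.
- by rewrite mulrC -ler_pdivlMr// ltW.
Qed.
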